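(* Let $u,d$ be positive integers with $u<d/2$ and $\gcd(u,d)=1$, and let $\mathbb K$ be a field. With the notation of the context, the map $\Phi_1$ in the minimal bigraded free resolution $0\to F_3\xrightarrow{\Phi_3} F_2\xrightarrow{\Phi_2}F_1\xrightarrow{\Phi_1}S\xrightarrow{\Phi_0}\mathrm{Rees}(\mathcal I)\to0$ of the $S$-module $\mathrm{Rees}(\mathcal I)$, whose term $F_1$ is $\bigoplus_{n=1}^{q+2}S(-(b_n,|\sigma_n-\tau_n|))$, can be made explicit as $$\Phi_1:\ \bigoplus_{n=1}^{q+2}S(-(b_n,|\sigma_n-\tau_n|))\to S,\qquad \mathbf e_n\mapsto F_{n,b_n},\quad n=1,\dots,q+2,$$ where $\mathbf e_1,\dots,\mathbf e_{q+2}$ is the canonical basis, $\mathrm{bideg}(\mathbf e_n)=(b_n,|\sigma_n-\tau_n|)$. Moreover, $\mathcal F_0=\{F_{n,b_n}\}_{n=1,\dots,q+2}$ is a minimal set of generators of the ideal $\ker(\Phi_0)\subset S$, and it is a reduced Gröbner basis of this ideal with respect to $\prec_l$.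
   Context: Setting: $R=\mathbb K[T_0,T_1]$, $S=\mathbb K[T_0,T_1,X_0,X_1,X_2]$, $\mathcal I=\langle T_0^d,\,T_0^{d-u}T_1^u,\,T_1^d\rangle\subset R$, $\mathrm{Rees}(\mathcal I)=\bigoplus_{n\ge0}\mathcal I^nZ^n\subset R[Z]$. $\Phi_0:S\to\mathrm{Rees}(\mathcal I)$ is the surjective $\mathbb K$-algebra morphism with $T_i\mapsto T_i$, $X_0\mapsto ZT_0^d$, $X_1\mapsto ZT_0^{d-u}T_1^u$, $X_2\mapsto ZT_1^d$; $\mathrm{Rees}(\mathcal I)$ is an $S$-module through $\Phi_0$. Bigrading: $\mathrm{bideg}(T_i)=(1,0)$, $\mathrm{bideg}(X_j)=(0,1)$, $\mathrm{bideg}(Z)=(-d,1)$. $S(a,b)_{(k,l)}=S_{(a+k,b+l)}$. Euclidean data: $a_0=d-u$, $a_1=u$, and for $1\le i\le p-1$, $a_{i-1}=q_ia_i+a_{i+1}$ with $0\le a_{i+1}<a_i$, where $p$ is such that $a_p=0$. Put $q=\sum_{i=1}^{p-1}q_i$. Slow Euclidean Remainder Sequence: $(b_1,c_1)=(d-u,u)$, $(\sigma_1,\tau_1,\alpha_1,\beta_1)=(0,1,1,0)$, and for $1\le n\le q$: if $b_n-c_n\ge c_n$, then $(b_{n+1},c_{n+1})=(b_n-c_n,c_n)$ and $(\sigma_{n+1},\tau_{n+1},\alpha_{n+1},\beta_{n+1})=(\sigma_n-\alpha_n,\tau_n-\beta_n,\alpha_n,\beta_n)$; if $b_n-c_n<c_n$,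 then $(b_{n+1},c_{n+1})=(c_n,b_n-c_n)$ and $(\sigma_{n+1},\tau_{n+1},\alpha_{n+1},\beta_{n+1})=(\alpha_n,\beta_n,\sigma_n-\alpha_n,\tau_n-\beta_n)$. One has $\sigma_nu+\tau_n(d-u)=b_n$. Moreover $b_{q+2}=0$ and, by convention, $(\sigma_{q+2},\tau_{q+2})=(d-u,-u)$, so $|\sigma_{q+2}-\tau_{q+2}|=d$. Polynomials: for $1\le n\le q+1$, $F_{n,b_n}=T_0^{b_n}X_0^{-\sigma_n}X_2^{\tau_n}-T_1^{b_n}X_1^{\tau_n-\sigma_n}$ if $\sigma_n\le0$, and $F_{n,b_n}=T_0^{b_n}X_1^{\sigma_n-\tau_n}-T_1^{b_n}X_0^{\sigma_n}X_2^{-\tau_n}$ if $\sigma_n>0$. Also $F_{q+2,0}=X_0^{d-u}X_2^u-X_1^d$ if $\sigma_q>0$, and $F_{q+2,0}=X_1^d-X_0^{d-u}X_2^u$ if $\sigma_q<0$ (one always has $\sigma_q\neq0$). Order: $\prec_l$ is the lexicographic order on the monomials of $S$ with $X_2\prec_lX_1\prec_lX_0\prec_lT_1\prec_lT_0$ if $\sigma_q>0$, and $X_2\prec_lX_0\prec_lX_1\prec_lT_1\prec_lT_0$ if $\sigma_q\le0$. *)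

(* Defs.v *)
From mathcomp Require Import all_boot all_order all_algebra.
From mathcomp Require Import mpoly.

Set Implicit Arguments.
Unset Strict Implicit.
Unset Printing Implicit Defensive.

Import Order.TTheory GRing.Theory Num.Theory.
Local Open Scope ring_scope.

Definition ideal_gen (A : comNzRingType) (P : A -> Prop) (x : A) : Prop :=
  exists n (c g : 'I_n -> A), (forall i, P (g i)) /\ x = \sum_i c i * g i.

(* The power of exponent 0 is the unit ideal, generated by the empty product. *)
Definition ideal_pow (A : comNzRingType) (a : A -> Prop) (n : nat) : A -> Prop :=
  ideal_gen (fun x => exists g : 'I_n -> A,
    (forall i, a (g i)) /\ x = \prod_i g i).

(* The sub-family of g indexed by J, as a set. *)
Definition subfam (A : Type) (I : finType) (g : I -> A) (J : {set I}) (y : A) :=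
  exists2 i, i \in J & y = g i.

Definition generates (A : comNzRingType) (P : A -> Prop) (a : A -> Prop) :=
  forall x, a x <-> ideal_gen P x.

Definition minimal_generators (A : comNzRingType) (I : finType) (g : I -> A)
    (a : A -> Prop) : Prop :=
  generates (subfam g setT) a /\
  forall J : {set I}, J \proper setT -> ~ generates (subfam g J) a.

Section Groebner.
Variables (n : nat) (K : fieldType) (lt : rel 'X_{1..n}).
Implicit Types (f : {mpoly K[n]}) (P : {mpoly K[n]} -> Prop).

(* m is the leading monomial of f (no such m if f = 0); the function mlead of
   the library is for degrevlex only. *)
Definition is_lead f (m : 'X_{1..n}) : Prop :=
  m \in msupp f /\ forall m', m' \in msupp f -> m' != m -> lt m' m.

Definition lead_terms P (x : {mpoly K[n]}) : Prop :=
  exists f m, [/\ P f, is_lead f m & x = f@_m *: 'X_[m]].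

Definition groebner_basis (I : finType) (g : I -> {mpoly K[n]})
    (a : {mpoly K[n]} -> Prop) : Prop :=
  (forall i, a (g i)) /\
  forall x, ideal_gen (lead_terms (subfam g setT)) x
            <-> ideal_gen (lead_terms a) x.

Definition reduced_groebner_basis (I : finType) (g : I -> {mpoly K[n]})
    (a : {mpoly K[n]} -> Prop) : Prop :=
  [/\ groebner_basis g a,
      forall i, exists2 m, is_lead (g i) m & (g i)@_m = 1
    & forall i m, m \in msupp (g i) ->
        ~ ideal_gen (lead_terms (subfam g (setT :\ i))) 'X_[m] ].

End Groebner.

(* Lexicographic order; s lists the variables from largest to smallest. *)
Definition lex_lt (n : nat) (s : seq 'I_n) : rel 'X_{1..n} := fun m1 m2 =>
  (([seq m1 i | i <- s] : seqlexi nat) < [seq m2 i | i <- s])%O.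

(* S = K[T0,T1,X0,X1,X2] is {mpoly K[5]}, R = K[T0,T1] is {mpoly K[2]}, and
   R[Z] is {poly {mpoly K[2]}}, with 'X as Z. *)
Definition iT0 : 'I_5 := @Ordinal 5 0 isT.
Definition iT1 : 'I_5 := @Ordinal 5 1 isT.
Definition iX0 : 'I_5 := @Ordinal 5 2 isT.
Definition iX1 : 'I_5 := @Ordinal 5 3 isT.
Definition iX2 : 'I_5 := @Ordinal 5 4 isT.

Definition rT0 : 'I_2 := @Ordinal 2 0 isT.
Definition rT1 : 'I_2 := @Ordinal 2 1 isT.

Section Rees.
Variables (K : fieldType) (u d : nat).

Definition monI : {mpoly K[2]} -> Prop :=
  ideal_gen (fun x => [\/ x = 'X_rT0 ^+ d,
                          x = 'X_rT0 ^+ (d - u) * 'X_rT1 ^+ u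
                        | x = 'X_rT1 ^+ d]).

(* The Rees algebra of monI, as a subset of R[Z]. *)
Definition Rees (y : {poly {mpoly K[2]}}) : Prop := forall n, ideal_pow monI n y`_n.

Definition Phi0_var (i : 'I_5) : {poly {mpoly K[2]}} :=
  nth 0 [:: ('X_rT0)%:P; ('X_rT1)%:P;
            'X * ('X_rT0 ^+ d)%:P;
            'X * ('X_rT0 ^+ (d - u) * 'X_rT1 ^+ u)%:P;
            'X * ('X_rT1 ^+ d)%:P] i.

Definition Phi0 : {mpoly K[5]} -> {poly {mpoly K[2]}} :=
  mmap (polyC \o @mpolyC 2 K) Phi0_var.

Definition kerPhi0 (x : {mpoly K[5]}) : Prop := Phi0 x = 0.

Definition bideg (m : 'X_{1..5}) : int * int :=
  ((m iT0 + m iT1)%N%:Z, (m iX0 + m iX1 + m iX2)%N%:Z).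

Definition bihomog (a : int * int) (x : {mpoly K[5]}) : Prop :=
  forall m, m \in msupp x -> bideg m = a.

(* On R[Z]: bideg Ti = (1,0) and bideg Z = (-d,1). *)
Definition bihomogZ (a : int * int) (y : {poly {mpoly K[2]}}) : Prop :=
  forall n m, m \in msupp y`_n -> ((mdeg m)%:Z - (d * n)%N%:Z, n%:Z) = a.

(* The component of bidegree a of the free module
   S(- e 0) + ... + S(- e (r - 1)), whose basis vector i has bidegree e i. *)
Definition free_bihomog (r : nat) (e : 'I_r -> int * int) (a : int * int)
    (v : 'rV[{mpoly K[5]}]_r) : Prop := forall i, bihomog (a - e i) (v 0 i).

Definition graded (A B : Type) (gA : int * int -> A -> Prop)
    (gB : int * int -> B -> Prop) (f : A -> B) : Prop :=
  forall a v, gA a v -> gB a (f v).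

Definition exact (A B : Type) (C : zmodType) (f : A -> B) (g : B -> C) :=
  forall b, g b = 0 <-> exists a, b = f a.

Definition maxS : {mpoly K[5]} -> Prop := ideal_gen (fun x => exists i, x = 'X_i).

(* 0 -> F3 -> F2 -> F1 -> S -> Rees -> 0 is a minimal bigraded free resolution,
   where Fi is free of rank ri with basis vectors of bidegrees ei. *)
Record min_bigraded_resolution
    (r1 : nat) (e1 : 'I_r1 -> int * int)
    (r2 : nat) (e2 : 'I_r2 -> int * int)
    (r3 : nat) (e3 : 'I_r3 -> int * int)
    (Phi1 : {linear 'rV[{mpoly K[5]}]_r1 -> ({mpoly K[5]})^o})
    (Phi2 : {linear 'rV[{mpoly K[5]}]_r2 -> 'rV[{mpoly K[5]}]_r1})
    (Phi3 : {linear 'rV[{mpoly K[5]}]_r3 -> 'rV[{mpoly K[5]}]_r2}) : Prop := {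
  res_inj3 : injective Phi3;
  res_exact2 : exact Phi3 Phi2;
  res_exact1 : exact Phi2 Phi1;
  res_exact0 : exact Phi1 Phi0;
  res_onto : forall y, Rees y <-> exists x, y = Phi0 x;
  res_graded3 : graded (free_bihomog e3) (free_bihomog e2) Phi3;
  res_graded2 : graded (free_bihomog e2) (free_bihomog e1) Phi2;
  res_graded1 : graded (free_bihomog e1) bihomog Phi1;
  res_graded0 : graded bihomog bihomogZ Phi0;
  res_min3 : forall v i, maxS (Phi3 v 0 i);
  res_min2 : forall v i, maxS (Phi2 v 0 i);
  res_min1 : forall v, maxS (Phi1 v)
}.

End Rees.

(* These conditions determine p, the a i for i <= p and the k i for
   1 <= i < p (k i is the quotient written q_i in mathematics). *)
Definition euclid_data (u d p : nat) (a k : nat -> nat) : Prop :=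
  [/\ a 0%N = (d - u)%N, a 1%N = u, a p = 0%N
    & forall i, (0 < i < p)%N ->
        a i.-1 = (k i * a i + a i.+1)%N /\ (a i.+1 < a i)%N].

Record sers_state := SersState {
  st_b : nat; st_c : nat;
  st_sigma : int; st_tau : int; st_alpha : int; st_beta : int }.

(* The slow Euclidean remainder sequence.
   The truncated subtraction b - c is exact: c <= b holds at every step. *)
Definition sers_step (s : sers_state) : sers_state :=
  let: SersState b c sg ta al be := s in
  if (c <= b - c)%N
  then SersState (b - c) c (sg - al) (ta - be) al be
  else SersState c (b - c) al be (sg - al) (ta - be).

(* Term of index n >= 1. *)
Definition sers (u d n : nat) : sers_state :=
  iter n.-1 sers_step (SersState (d - u) u 0 1 1 0).

Section Generators.
Variables (u d q : nat).

(* b_n, sigma_n, tau_n for 1 <= n <= q + 2, with the convention at q + 2. *)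
Definition bn (n : nat) : nat :=
  if n == q.+2 then 0%N else st_b (sers u d n).
Definition sigman (n : nat) : int :=
  if n == q.+2 then (d - u)%N%:Z else st_sigma (sers u d n).
Definition taun (n : nat) : int :=
  if n == q.+2 then - u%:Z else st_tau (sers u d n).

(* The absolute values in exponents only convert nonnegative integers to nat:
   tau_n >= 0 when sigma_n <= 0 and tau_n <= 0 when sigma_n > 0. *)
Definition Fgen (K : fieldType) (n : nat) : {mpoly K[5]} :=
  let T0 := 'X_iT0 in let T1 := 'X_iT1 in
  let X0 := 'X_iX0 in let X1 := 'X_iX1 in let X2 := 'X_iX2 in
  let b := bn n in let sg := sigman n in let ta := taun n in
  if n == q.+2 then
    if 0 < sigman q then X0 ^+ (d - u) * X2 ^+ u - X1 ^+ d
    else X1 ^+ d - X0 ^+ (d - u) * X2 ^+ u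
  else if sg <= 0 then
    T0 ^+ b * X0 ^+ `|- sg|%N * X2 ^+ `|ta|%N - T1 ^+ b * X1 ^+ `|ta - sg|%N
  else
    T0 ^+ b * X1 ^+ `|sg - ta|%N - T1 ^+ b * X0 ^+ `|sg|%N * X2 ^+ `|- ta|%N.

Definition prec_l : rel 'X_{1..5} :=
  if 0 < sigman q then lex_lt [:: iT0; iT1; iX0; iX1; iX2]
  else lex_lt [:: iT0; iT1; iX1; iX0; iX2].

(* Index i : 'I_(q + 2) stands for n = i + 1. *)
Definition F0 (K : fieldType) (i : 'I_q.+2) : {mpoly K[5]} := Fgen K i.+1.

Definition deg1 (i : 'I_q.+2) : int * int :=
  ((bn i.+1)%:Z, `|sigman i.+1 - taun i.+1|).

End Generators.

(* Main.v *)
(* The binomial attached to a pair (sigma, tau) is T0^b A - T1^b B with A, B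
   monomials in the X_j, and the one attached to the difference of a pair v, w
   (b_w <= b_v) of the Euclidean sequence is T0^(b_v-b_w) A_v B_w
   - T1^(b_v-b_w) B_v A_w. Multiplied by T0^(b_w) or T1^(b_w), it lies in the
   ideal generated by the binomials of v and w, and these two powers generate
   the whole colon ideal of the previously created generators by the new one.
   So the kernel is built from a complete intersection by q mapping cones along
   Koszul complexes on (T0^c, T1^c); only the first cone is not minimal, and
   cancelling there leaves ranks q + 2, 2q and q - 1.
   Monomials of S with the same image under Phi_0 differ by a vector of the
   lattice Z^2 of all (sigma, tau); decomposing this vector along the successive
   pairs of the Euclidean sequence yields a generator whose leading monomial
   divides the larger of the two monomials. This gives both the generation of
   the kernel and the Groebner basis. *)
From HB Require Import structures.
Require Import Defs.
From mathcomp Require Import all_boot all_order all_algebra.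
From mathcomp Require Import ring zify.
From mathcomp Require Import mpoly.
Set Implicit Arguments.
Unset Strict Implicit.
Unset Printing Implicit Defensive.
Import Order.TTheory GRing.Theory Num.Theory.
Local Open Scope ring_scope.

(** * Monomial ideals *)

(** Two orders of the generators compete. The mapping cones need the order of creation, where each
    new binomial comes from the newest one and one kept from before; the statement lists the
    binomials by the step at which they stand first in the pair. The homological part is therefore
    proved for an abstract family indexed by creation ([tower]), and the permutation [pos]
    transports it. The ranks come from Koszul relations. At each step the Koszul relation of the
    pair is T1^c times one new syzygy minus T0^c times the other, so that of the complete
    intersection follows from the first two syzygies: this is the cancellation in the first cone.
    The syzygies of the step before give the same Koszul relation again; equating the two
    expressions yields one second syzygy for every two consecutive steps. The two vectors of a pair
    lie in opposite quadrants, so a subtraction adds absolute values and the arithmetic stays in the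
    natural numbers. Their determinant is 1 or -1, and at the end both have b = 1, which forces the
    last difference to be (d-u,-u) up to sign. *)

Section Ideals.
Variables (A : comNzRingType) (P : A -> Prop).

Lemma ideal_gen_mem x : P x -> ideal_gen P x.
Proof.
by move=> Px; exists 1%N, (fun _ => 1), (fun _ => x); split=> //; rewrite big_ord1 mul1r.
Qed.

Lemma ideal_gen0 : ideal_gen P 0.
Proof. by exists 0%N, (fun _ => 0), (fun _ => 0); split=> [[]|] //; rewrite big_ord0. Qed.

Lemma ideal_genD x y : ideal_gen P x -> ideal_gen P y -> ideal_gen P (x + y).
Proof.
move=> [n [c [g [Pg ->]]]] [n' [c' [g' [Pg' ->]]]].
exists (n + n')%N, (fun i => match split i with inl j => c j | inr j => c' j end),
  (fun i => match split i with inl j => g j | inr j => g' j end); split.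
  by move=> i; case: (split i).
rewrite big_split_ord /=; congr (_ + _); apply: eq_bigr => i _.
  by rewrite (unsplitK (inl _ i)).
by rewrite (unsplitK (inr _ i)).
Qed.

Lemma ideal_genM a x : ideal_gen P x -> ideal_gen P (a * x).
Proof.
move=> [n [c [g [Pg ->]]]]; exists n, (fun i => a * c i), g; split=> //.
by rewrite mulr_sumr; apply: eq_bigr => i _; rewrite mulrA.
Qed.

Lemma ideal_genN x : ideal_gen P x -> ideal_gen P (- x).
Proof. by rewrite -mulN1r; apply: ideal_genM. Qed.

Lemma ideal_gen_sum (I : Type) (r : seq I) (Q : pred I) (F : I -> A) :
  (forall i, Q i -> ideal_gen P (F i)) -> ideal_gen P (\sum_(i <- r | Q i) F i).
Proof.
by move=> h; elim/big_ind: _ => //; [apply: ideal_gen0 | apply: ideal_genD].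
Qed.

End Ideals.

Lemma ideal_gen_trans (A : comNzRingType) (P Q : A -> Prop) x :
  (forall y, P y -> ideal_gen Q y) -> ideal_gen P x -> ideal_gen Q x.
Proof.
move=> PQ [n [c [g [Pg ->]]]]; apply: ideal_gen_sum => i _.
exact/ideal_genM/PQ.
Qed.

Section MonomialIdeal.
Variable K : fieldType.
Local Notation S := {mpoly K[5]}.
Implicit Types (g h : S) (m : 'X_{1..5}).

Lemma mpoly_divX m g : (forall m', m' \in msupp g -> (m <= m')%MM) ->
  exists h, g = h * 'X_[m].
Proof.
move=> le_m; exists (\sum_(m' <- msupp g) g@_m' *: 'X_[m' - m]).
rewrite mulr_suml {1}[g]mpolyE !big_seq; apply: eq_bigr => m' /le_m le_mm'.
by rewrite -scalerAl -mpolyXD submK.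
Qed.

Lemma msuppMXP m g m' : (m + m')%MM \in msupp (g * 'X_[m]) = (m' \in msupp g).
Proof. by rewrite !mcoeff_msupp mcoeffMX. Qed.

(* Membership in the monomial ideal (T0^a, T1^b), see inT_decomp. *)
Definition inT (a b : nat) g :=
  forall m, m \in msupp g -> (a <= m iT0)%N || (b <= m iT1)%N.

Lemma inTD a b g h : inT a b g -> inT a b h -> inT a b (g + h).
Proof. by move=> hg hh m /msuppD_le; rewrite mem_cat => /orP[/hg|/hh]. Qed.

Lemma inTN a b g : inT a b g -> inT a b (- g).
Proof. by move=> hg m; rewrite (perm_mem (msuppN _)); apply: hg. Qed.

Lemma inTB a b g h : inT a b g -> inT a b h -> inT a b (g - h).
Proof. by move=> hg hh; apply: inTD => //; apply: inTN. Qed.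

Lemma inTM a b g h : inT a b g -> inT a b (h * g).
Proof.
move=> hg m /msuppM_le /allpairsP[[m1 m2] /= [_ /hg h2 ->]].
by rewrite !mnmDE; case/orP: h2; lia.
Qed.

Lemma inTW a b a' b' g : (a' <= a)%N -> (b' <= b)%N -> inT a b g -> inT a' b' g.
Proof. by move=> ha hb hg m /hg; lia. Qed.

Lemma inT0X a b e : (a <= e)%N -> inT a b ('X_iT0 ^+ e).
Proof.
move=> le m; rewrite mpolyXn msuppX inE => /eqP ->.
by rewrite !mulmnE !mnm1E /= mul1n le.
Qed.

Lemma inT1X a b e : (b <= e)%N -> inT a b ('X_iT1 ^+ e).
Proof.
move=> le m; rewrite mpolyXn msuppX inE => /eqP ->.
by rewrite !mulmnE !mnm1E /= mul1n le orbT.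
Qed.

(** Membership is read off the T-exponents of each monomial: T0^e shifts only that of T0, and a
    monomial in the X_j shifts neither. *)
Lemma inT_cancel a b e m g : m iT0 = 0%N -> m iT1 = 0%N ->
  inT (a + e) b (g * ('X_iT0 ^+ e * 'X_[m])) -> inT a b g.
Proof.
move=> m0 m1; rewrite mpolyXn -mpolyXD => h m'; rewrite -(msuppMXP (U_(iT0) *+ e + m)).
by move/h; rewrite !mnmDE !mulmnE !mnm1E m0 m1 /=; lia.
Qed.

Lemma inT_decomp a b g : inT a b g ->
  exists h1 h2, g = h1 * 'X_iT0 ^+ a + h2 * 'X_iT1 ^+ b.
Proof.
move=> hg.
exists (\sum_(m <- msupp g | (a <= m iT0)%N) g@_m *: 'X_[m - U_(iT0) *+ a]).
exists (\sum_(m <- msupp g | ~~ (a <= m iT0)%N) g@_m *: 'X_[m - U_(iT1) *+ b]).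
rewrite {1}[g]mpolyE (bigID (fun m : 'X_{1..5} => (a <= m iT0)%N)) /=.
rewrite !mpolyXn !mulr_suml; congr (_ + _); rewrite [LHS]big_seq_cond [RHS]big_seq_cond.
  apply: eq_bigr => m /andP[_ am]; rewrite -scalerAl -mpolyXD submK //.
  apply/mnm_lepP => i; rewrite mulmnE mnm1E; case: eqP => [<-|]; rewrite ?mul1n //.
apply: eq_bigr => m /andP[/hg hm am]; rewrite -scalerAl -mpolyXD submK //.
apply/mnm_lepP => i; rewrite mulmnE mnm1E; case: eqP => [<-|]; rewrite ?mul1n //.
by move: hm; rewrite (negbTE am).
Qed.

Lemma T0T1_regular c g h :
  g * 'X_iT0 ^+ c + h * 'X_iT1 ^+ c = 0 ->
  exists l, g = l * 'X_iT1 ^+ c /\ h = - l * 'X_iT0 ^+ c.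
Proof.
move=> e0; have {}e0 : h * 'X_iT1 ^+ c = - g * 'X_iT0 ^+ c.
  by apply/eqP; rewrite -subr_eq0 mulNr opprK addrC e0.
have [l hl] : exists l, h = l * 'X_iT0 ^+ c.
  rewrite mpolyXn; apply: mpoly_divX => m; rewrite -(msuppMXP (U_(iT1) *+ c)).
  rewrite -mpolyXn e0 => /msuppM_le /allpairsP[[m1 m2] /= [_]].
  rewrite mpolyXn msuppX inE => /eqP -> /(congr1 (fun m : 'X_{1..5} => m iT0)).
  rewrite !mnmDE !mulmnE !mnm1E /= => E.
  by apply/mnm_lepP => i; rewrite mulmnE mnm1E; case: eqP => [<-|]; lia.
exists (- l); split; last by rewrite opprK.
have T0nz : 'X_iT0 ^+ c != 0 :> S by rewrite mpolyXn -msupp_eq0 msuppX.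
apply: (mulIf T0nz); apply: oppr_inj; rewrite -mulNr -e0 hl; ring.
Qed.

End MonomialIdeal.

(** * Iterated mapping cones *)
Section Tower.
Variables (K : fieldType) (q : nat).
Local Notation S := {mpoly K[5]}.
Local Notation T0 := ('X_iT0 : S).
Local Notation T1 := ('X_iT1 : S).
Variables (b : nat -> nat) (A B : nat -> 'X_{1..5}) (iV iW o : nat -> nat).

Definition binom i : S := T0 ^+ b i * 'X_[A i] - T1 ^+ b i * 'X_[B i].
Local Notation C := binom.

(* Step k takes the pair formed by the newest element C_(k+1) and by C_(o k),
   sorted as iV k, iW k by decreasing b, and creates C_(k+2). *)
Record tower (dg : nat -> nat) : Prop := Tower {
  tw_A : forall i, bideg (A i) = (0, (dg i)%:Z);
  tw_B : forall i, bideg (B i) = (0, (dg i)%:Z);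
  tw_dg : forall i, (0 < dg i)%N;
  tw_newest : forall k, (k < q)%N ->
    (iV k = k.+1 /\ iW k = o k) \/ (iV k = o k /\ iW k = k.+1);
  tw_o0 : o 0 = 0%N;
  tw_oS : forall k, (k.+1 < q)%N -> o k.+1 = iW k;
  tw_bW : forall k, (k < q)%N -> (0 < b (iW k) <= b (iV k))%N;
  tw_bD : forall k, (k < q)%N -> b k.+2 = (b (iV k) - b (iW k))%N;
  tw_AD : forall k, (k < q)%N -> A k.+2 = (A (iV k) + B (iW k))%MM;
  tw_BD : forall k, (k < q)%N -> B k.+2 = (B (iV k) + A (iW k))%MM;
  tw_C : forall i, (i < 2)%N -> C i != 0;
  tw_syz01 : forall g h : S, g * C 0 + h * C 1 = 0 ->
    exists l, g = l * C 1 /\ h = - l * C 0 }.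

Variable dg : nat -> nat.
Hypothesis tw : tower dg.
Let newest := tw_newest tw.
Let o0 := tw_o0 tw.
Let oS := tw_oS tw.
Let bD := tw_bD tw.
Let AD := tw_AD tw.
Let BD := tw_BD tw.
Let C_neq0 := tw_C tw.
Let syz01 := tw_syz01 tw.

Let A_noT i : A i iT0 = 0%N /\ A i iT1 = 0%N.
Proof. by have /(congr1 fst) := tw_A tw i; rewrite /bideg /=; lia. Qed.

Let bW_le k : (k < q)%N -> (b (iW k) <= b (iV k))%N.
Proof. by move=> /(tw_bW tw)/andP[]. Qed.

Lemma o_le k : (k < q)%N -> (o k <= k)%N.
Proof.
elim: k => [|k IH] kq; first by rewrite o0.
have := IH (ltnW kq); rewrite oS //; case: (newest (ltnW kq)) => -[_ ->]; lia.
Qed.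

Lemma iV_le k : (k < q)%N -> (iV k <= k.+1)%N.
Proof. by move=> kq; have := o_le kq; case: (newest kq) => -[-> _]; lia. Qed.

Lemma iW_le k : (k < q)%N -> (iW k <= k.+1)%N.
Proof. by move=> kq; have := o_le kq; case: (newest kq) => -[_ ->]; lia. Qed.

Lemma iV_neq_iW k : (k < q)%N -> iV k != iW k.
Proof. by move=> kq; have := o_le kq; case: (newest kq) => -[-> ->]; lia. Qed.

(** Coefficient of C_i in [rel1] moved to one side; [syz2] does the same for [rel2]. The indicator
    form is defined for every natural i, so sums of any sufficient length can be taken. *)
Definition syz1 k i : S :=
  T0 ^+ b (iW k) *+ (i == k.+2) - 'X_[B (iW k)] *+ (i == iV k)
  + T1 ^+ (b (iV k) - b (iW k)) * 'X_[B (iV k)] *+ (i == iW k).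

Definition syz2 k i : S :=
  T1 ^+ b (iW k) *+ (i == k.+2) - 'X_[A (iW k)] *+ (i == iV k)
  + T0 ^+ (b (iV k) - b (iW k)) * 'X_[A (iV k)] *+ (i == iW k).

(** Naming the truncated difference turns the exponent of iV into a sum, which [exprD] and [ring]
    can handle. *)
Lemma bV k : (k < q)%N -> exists e,
  (b (iV k) - b (iW k) = e)%N /\ b (iV k) = (e + b (iW k))%N.
Proof. by move=> kq; eexists; split; first reflexivity; rewrite subnK // bW_le. Qed.

Lemma rel1 k : (k < q)%N -> T0 ^+ b (iW k) * C k.+2 =
  'X_[B (iW k)] * C (iV k) - T1 ^+ (b (iV k) - b (iW k)) * 'X_[B (iV k)] * C (iW k).
Proof.
move=> kq; have [e [E1 E2]] := bV kq.
by rewrite /C bD // AD // BD // !mpolyXD E1 E2 !exprD; ring.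
Qed.

Lemma rel2 k : (k < q)%N -> T1 ^+ b (iW k) * C k.+2 =
  'X_[A (iW k)] * C (iV k) - T0 ^+ (b (iV k) - b (iW k)) * 'X_[A (iV k)] * C (iW k).
Proof.
move=> kq; have [e [E1 E2]] := bV kq.
by rewrite /C bD // AD // BD // !mpolyXD E1 E2 !exprD; ring.
Qed.

Lemma sum_delta n j (x : S) (F : nat -> S) : (j < n)%N ->
  \sum_(i < n) (x *+ (val i == j)) * F i = x * F j.
Proof.
move=> jn; rewrite (bigD1 (Ordinal jn)) //= eqxx mulr1n big1 ?addr0 // => i ij.
by rewrite (_ : (val i == j) = false) ?mul0r //; apply: contraNF ij => /eqP E; apply/eqP/val_inj.
Qed.

Lemma syz1_C k n : (k < q)%N -> (k.+2 < n)%N -> \sum_(i < n) syz1 k i * C i = 0.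
Proof.
move=> kq kn; have hV := iV_le kq; have hW := iW_le kq.
under eq_bigr do rewrite /syz1 mulrDl mulrBl.
by rewrite big_split sumrB /= !sum_delta ?rel1 //; try lia; ring.
Qed.

Lemma syz2_C k n : (k < q)%N -> (k.+2 < n)%N -> \sum_(i < n) syz2 k i * C i = 0.
Proof.
move=> kq kn; have hV := iV_le kq; have hW := iW_le kq.
under eq_bigr do rewrite /syz2 mulrDl mulrBl.
by rewrite big_split sumrB /= !sum_delta ?rel2 //; try lia; ring.
Qed.

Lemma syz_above k i : (k < q)%N -> (k.+2 < i)%N -> syz1 k i = 0 /\ syz2 k i = 0.
Proof.
move=> kq ki; have hV := iV_le kq; have hW := iW_le kq; rewrite /syz1 /syz2.
have -> : (i == k.+2) = false by lia.
have -> : (i == iV k) = false by lia.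
have -> : (i == iW k) = false by lia.
by rewrite !mulr0n !subr0 !addr0.
Qed.

Lemma syz_top k : (k < q)%N ->
  syz1 k k.+2 = T0 ^+ b (iW k) /\ syz2 k k.+2 = T1 ^+ b (iW k).
Proof.
move=> kq; have hV := iV_le kq; have hW := iW_le kq; rewrite /syz1 /syz2 eqxx.
have -> : (k.+2 == iV k) = false by lia.
have -> : (k.+2 == iW k) = false by lia.
by rewrite !mulr0n !subr0 !addr0.
Qed.

(** Eliminating C_(k+2) between the two relations of step k leaves the Koszul relation of the pair
    they came from. *)
Lemma koszul_same_step k i : (k < q)%N ->
  T1 ^+ b (iW k) * syz1 k i - T0 ^+ b (iW k) * syz2 k i =
  C (iW k) *+ (i == iV k) - C (iV k) *+ (i == iW k).
Proof.
move=> kq; have [e [E1 E2]] := bV kq; rewrite /syz1 /syz2 /C E1 E2 !exprD.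
by case: (i == k.+2); case: (i == iV k); case: (i == iW k); rewrite ?mulr1n ?mulr0n; ring.
Qed.

(** Eliminating C_(iV k) instead leaves the Koszul relation of C_(k+2) and C_(iW k), which are
    exactly the pair of step k+1. *)
Lemma koszul_prev_step k i : (k < q)%N ->
  'X_[A (iW k)] * syz1 k i - 'X_[B (iW k)] * syz2 k i =
  C (iW k) *+ (i == k.+2) - C k.+2 *+ (i == iW k).
Proof.
move=> kq; rewrite /syz1 /syz2 /C bD // AD // BD // !mpolyXD.
by case: (i == k.+2); case: (i == iV k); case: (i == iW k); rewrite ?mulr1n ?mulr0n; ring.
Qed.

Lemma inT_C i : inT (b i) (b i) (C i).
Proof. by apply: inTB; rewrite mulrC; apply/inTM; [apply: inT0X | apply: inT1X]. Qed.

(* Multiplying by T1^c rewrites g C_(k+2) through C_(iV k) and C_(iW k), which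
   reduces the claim to the same one for C_(k+1). *)
Lemma colonP k : (k < q)%N -> forall (g : S) (h : nat -> S),
  g * C k.+2 = \sum_(i < k.+2) h i * C i -> inT (b (iW k)) (b (iW k)) g.
Proof.
(* The colon statement for C_(k+1), with exponent read at [o k]. For k = 0 it comes from the
   complete intersection C_0, C_1; since [o k.+1 = iW k], the conclusion at k is [prev k.+1]. *)
pose prev k := forall (g : S) (h : nat -> S),
  g * C k.+1 = \sum_(i < k.+1) h i * C i -> inT (b (o k)) (b (o k)) g.
have step j : (j < q)%N -> prev j -> forall (g : S) (h : nat -> S),
  g * C j.+2 = \sum_(i < j.+2) h i * C i -> inT (b (iW j)) (b (iW j)) g.
  move=> jq IH g h; rewrite big_ord_recr /=.
  set s := \sum_(i < _) _ => E; have {E} Es : s = g * C j.+2 - h j.+1 * C j.+1.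
    by rewrite E; ring.
  have R := rel2 jq; have oj := o_le jq; have le_b := bW_le jq.
  set c := b (iW j) in R le_b *; set e := (b (iV j) - c)%N in R *.
  have Rg f : T1 ^+ c * (g * C j.+2 - f) = g * ('X_[A (iW j)] * C (iV j)
      - T0 ^+ e * 'X_[A (iV j)] * C (iW j)) - T1 ^+ c * f.
    by rewrite -R; ring.
  have sumE (x y : S) : \sum_(i < j.+1) (x * h i + y *+ (val i == o j)) * C i
      = x * s + y * C (o j).
    rewrite mulr_sumr -(@sum_delta j.+1 (o j)) ?ltnS // -big_split /=.
    by apply: eq_bigr => i _; rewrite mulrDl mulrA.
  case: (newest jq) => -[VE WE].
  (* The newest element is iV, so after multiplication by T1^c the coefficient of C_(j+1) is this
     difference; the T1^c term is already in the ideal. *)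
  - have inTA : inT c c (g * 'X_[A (iW j)] - h j.+1 * T1 ^+ c).
      rewrite /c WE; apply: (IH _ (fun i => T1 ^+ c * h i
        + g * (T0 ^+ e * 'X_[A (iV j)]) *+ (i == o j))).
      by rewrite sumE Es Rg /e /c VE WE; ring.
    apply: (@inT_cancel _ _ _ 0 (A (iW j))); rewrite ?(A_noT _).1 ?(A_noT _).2 //.
    rewrite addn0 expr0 mul1r -[_ * _](subrK (h j.+1 * T1 ^+ c)).
    by apply: inTD => //; apply/inTM/inT1X.
  (* The newest element is iW and b (o j) = c + e. The surplus e in the T0-exponent is exactly what
     dividing by T0^e consumes. *)
  - have inTA : inT (c + e) c (g * (T0 ^+ e * 'X_[A (iV j)]) + h j.+1 * T1 ^+ c).
      apply: (@inTW _ (b (o j)) (b (o j))); rewrite /e -?VE ?subnKC //.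
      rewrite VE; apply: (IH _ (fun i => - T1 ^+ c * h i
        + g * 'X_[A (iW j)] *+ (i == o j))).
      by rewrite sumE mulNr Es Rg /e /c VE WE; ring.
    apply: (@inT_cancel _ _ _ e (A (iV j))); rewrite ?(A_noT _).1 ?(A_noT _).2 //.
    rewrite -[_ * _](addrK (h j.+1 * T1 ^+ c)).
    by apply: inTB => //; apply/inTM/inT1X.
move=> kq; apply: (step _ kq).
elim: k kq => [|k IH] kq g h; last by rewrite oS //; exact: (step _ (ltnW kq) (IH (ltnW kq))).
rewrite o0 big_ord1 /= => E.
have [|l [_ ->]] := syz01 (g := - h 0%N) (h := g); first by rewrite E; ring.
exact/inTM/inT_C.
Qed.

Lemma syz_span n0 : (n0 < q)%N -> forall g : nat -> S,
  \sum_(i < n0.+3) g i * C i = 0 ->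
  exists h1 h2 : nat -> S, forall i, (i < n0.+3)%N ->
    g i = \sum_(k < n0.+1) (h1 k * syz1 k i + h2 k * syz2 k i).
Proof.
(* The top coefficient lies in (T0^c, T1^c) by [colonP], and T0^c, T1^c are the top coordinates of
   the two syzygies of step n; subtracting multiples of them clears it. *)
have reduce n : (n < q)%N -> forall g : nat -> S, \sum_(i < n.+3) g i * C i = 0 ->
    exists x y, let g' i := g i - (x * syz1 n i + y * syz2 n i) in
      g' n.+2 = 0 /\ \sum_(i < n.+2) g' i * C i = 0.
  move=> nq g E.
  have : inT (b (iW n)) (b (iW n)) (g n.+2).
    apply: (colonP nq (h := fun i => - g i)).
    under eq_bigr do rewrite mulNr.
    apply/eqP; rewrite sumrN -addr_eq0 addrC; apply/eqP.
    by rewrite -[RHS]E [RHS]big_ord_recr.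
  move=> /inT_decomp[x [y Exy]].
  exists x, y => g'.
  have g'0 : g' n.+2 = 0.
    by rewrite /g' (syz_top nq).1 (syz_top nq).2 Exy subrr.
  split=> //; transitivity (\sum_(i < n.+3) g' i * C i).
    by rewrite [RHS]big_ord_recr /= g'0 mul0r addr0.
  rewrite /g'; under eq_bigr do rewrite mulrBl mulrDl -!mulrA.
  by rewrite sumrB big_split /= -!mulr_sumr syz1_C // syz2_C // E; ring.
elim: n0 => [|n IH] nq g /(reduce _ nq) [x [y [g'0 E]]].
  move: E; rewrite 2!big_ord_recr big_ord0 /= add0r => /syz01[l [l0 l1]].
  (* What remains is a multiple of the Koszul relation of C_0 and C_1, hence a combination of the
     syzygies of step 0. The sign of e depends on which of the two is iV 0. *)
  have [e eP] : exists e : S, forall i, (i < 3)%N ->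
      g i - (x * syz1 0 i + y * syz2 0 i) =
      e * (T1 ^+ b (iW 0) * syz1 0 i - T0 ^+ b (iW 0) * syz2 0 i).
    case: (newest nq); rewrite o0 => -[V0 W0]; [exists (- l) | exists l];
    by case=> [|[|[|//]]] _; rewrite koszul_same_step // ?g'0 ?l0 ?l1 V0 W0 /=
      ?mulr1n ?mulr0n; ring.
  exists (fun _ => x + e * T1 ^+ b (iW 0)), (fun _ => y - e * T0 ^+ b (iW 0)) => i.
  by move=> /eP /(canRL (subrK _)) ->; rewrite big_ord1 /=; ring.
have [h1 [h2 gE]] := IH (ltnW nq)
  (fun i => g i - (x * syz1 n.+1 i + y * syz2 n.+1 i)) E.
exists (fun k => if k == n.+1 then x else h1 k), (fun k => if k == n.+1 then y else h2 k).
move=> i; rewrite ltnS big_ord_recr /= eqxx leq_eqVlt => /predU1P[->|lt_i].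
  rewrite big1 ?add0r; last first.
    move=> k _; have kn := ltn_ord k.
    have [|//|-> ->] := @syz_above k n.+3; try lia.
    by rewrite !mulr0 addr0.
  by apply/eqP; rewrite -subr_eq0 g'0.
rewrite -[LHS](subrK (x * syz1 n.+1 i + y * syz2 n.+1 i)) gE //; congr (_ + _).
apply: eq_bigr => k _; rewrite ifN ?ifN //; have := ltn_ord k; lia.
Qed.

(** Orientation of the pair of step k: the Koszul relation changes sign when the newest element is
    iW rather than iV. *)
Definition eps k : S := if iV k == k.+1 then 1 else -1.

(** [sec1 j] and [sec2 j] are the coefficients, on [syz1] and [syz2], of the difference of two
    expressions of the Koszul relation of the pair of step j+1: [koszul_same_step] at j+1 and
    [koszul_prev_step] at j. *)
Definition sec1 j k : S :=
  T1 ^+ b (iW j.+1) *+ (k == j.+1) - eps j.+1 * 'X_[A (iW j)] *+ (k == j).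

Definition sec2 j k : S :=
  - T0 ^+ b (iW j.+1) *+ (k == j.+1) + eps j.+1 * 'X_[B (iW j)] *+ (k == j).

Lemma sec_above j k : (j.+1 < k)%N -> sec1 j k = 0 /\ sec2 j k = 0.
Proof.
move=> jk; rewrite /sec1 /sec2.
have -> : (k == j.+1) = false by lia.
have -> : (k == j) = false by lia.
by rewrite !mulr0n subr0 addr0.
Qed.

Lemma sec_top j : sec1 j j.+1 = T1 ^+ b (iW j.+1) /\ sec2 j j.+1 = - T0 ^+ b (iW j.+1).
Proof.
rewrite /sec1 /sec2 eqxx; have -> : (j.+1 == j) = false by lia.
by rewrite !mulr0n subr0 addr0.
Qed.

Lemma sec_syz j n i : (j.+1 < q)%N -> (j.+1 < n)%N ->
  \sum_(k < n) (sec1 j k * syz1 k i + sec2 j k * syz2 k i) = 0.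
Proof.
move=> jq jn; have jq' := ltnW jq; have jn' := ltnW jn.
have D1 m x := @sum_delta n m x (fun k => syz1 k i).
have D2 m x := @sum_delta n m x (fun k => syz2 k i).
under eq_bigr do rewrite /sec1 /sec2 mulrBl mulrDl.
rewrite big_split sumrB big_split /= !D1 // !D2 //.
transitivity (T1 ^+ b (iW j.+1) * syz1 j.+1 i - T0 ^+ b (iW j.+1) * syz2 j.+1 i
  - eps j.+1 * ('X_[A (iW j)] * syz1 j i - 'X_[B (iW j)] * syz2 j i)); first ring.
rewrite koszul_same_step // koszul_prev_step // /eps; have hW := iW_le jq'.
case: (newest jq); rewrite oS // => -[-> ->]; first by rewrite eqxx; ring.
have -> : (iW j == j.+2) = false by lia.
ring.
Qed.

Lemma sec_span n0 : (n0 < q)%N -> forall h1 h2 : nat -> S,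
  (forall i, (i < n0.+3)%N -> \sum_(k < n0.+1) (h1 k * syz1 k i + h2 k * syz2 k i) = 0) ->
  exists l : nat -> S, forall k, (k < n0.+1)%N ->
    h1 k = \sum_(j < n0) l j * sec1 j k /\ h2 k = \sum_(j < n0) l j * sec2 j k.
Proof.
(* Only the syzygies of step n reach coordinate n+2, where they are T0^c and T1^c; so the last two
   coefficients form a Koszul relation of these powers. *)
have top n : (n < q)%N -> forall h1 h2 : nat -> S,
    (forall i, (i < n.+3)%N -> \sum_(k < n.+1) (h1 k * syz1 k i + h2 k * syz2 k i) = 0) ->
    exists l, h1 n = l * T1 ^+ b (iW n) /\ h2 n = - l * T0 ^+ b (iW n).
  move=> nq h1 h2 /(_ n.+2 (ltnSn _)); rewrite big_ord_recr /= big1 ?add0r.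
    by rewrite (syz_top nq).1 (syz_top nq).2 => /T0T1_regular.
  move=> k _; have kn := ltn_ord k.
  have [|//|-> ->] := @syz_above k n.+2; try lia.
  by rewrite !mulr0 addr0.
elim: n0 => [|n IH] nq h1 h2 E; have [l [h1n h2n]] := top _ nq _ _ E.
  (* The first step alone carries no second syzygy: at coordinate iV 0 the relation reads l * C_(iW
     0) = 0, in a domain. *)
  have l0 : l = 0.
    have := E (iV 0%N); rewrite ltnW ?ltnS ?iV_le // => /(_ isT).
    rewrite big_ord1 /= h1n h2n => E0; have Vle := iV_le nq.
    have: l * C (iW 0) = 0.
      transitivity (l * (T1 ^+ b (iW 0) * syz1 0 (iV 0) - T0 ^+ b (iW 0) * syz2 0 (iV 0))).
        by rewrite koszul_same_step // eqxx (negbTE (iV_neq_iW nq)) mulr1n mulr0n subr0.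
      by rewrite -E0; ring.
    by move=> /eqP; rewrite mulf_eq0 (negbTE (C_neq0 _)) ?orbF ?ltnS ?iW_le // => /eqP.
  exists (fun _ => 0) => -[|//] _; rewrite !big_ord0 h1n h2n l0; split; ring.
have nq' := ltnW nq.
have [i lt_i|l' l'P] := IH nq' (fun k => h1 k - l * sec1 n k) (fun k => h2 k - l * sec2 n k).
  transitivity (\sum_(k < n.+2) (h1 k * syz1 k i + h2 k * syz2 k i)
     - l * \sum_(k < n.+2) (sec1 n k * syz1 k i + sec2 n k * syz2 k i)); last first.
    by rewrite E ?sec_syz ?mulr0 ?subr0 // ltnW.
  rewrite mulr_sumr -sumrB [RHS]big_ord_recr /= h1n h2n /sec1 /sec2 eqxx.
  have -> : (n.+1 == n) = false by lia.
  rewrite !mulr0n !mulr1n -[LHS]addr0; congr (_ + _); last ring.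
  by apply: eq_bigr => k _; rewrite /sec1 /sec2; ring.
exists (fun j => if j == n then l else l' j) => k; rewrite ltnS leq_eqVlt.
have split_sum (sec : nat -> nat -> S) : \sum_(j < n.+1) (if val j == n then l else l' j) * sec j k
    = \sum_(j < n) l' j * sec j k + l * sec n k.
  rewrite big_ord_recr /= eqxx; congr (_ + _).
  by apply: eq_bigr => j _; rewrite ifN //; have := ltn_ord j; lia.
rewrite !split_sum => /predU1P[->|lt_k].
  rewrite h1n h2n (sec_top n).1 (sec_top n).2 !big1 ?add0r ?mulrN ?mulNr //;
    by move=> j _; have jn := ltn_ord j; have [|Z1 Z2] := @sec_above j n.+1; rewrite ?Z1 ?Z2 ?mulr0.
by have [<- <-] := l'P _ lt_k; rewrite !subrK.
Qed.

Lemma T1_neq0 : T1 != 0.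
Proof. by rewrite -msupp_eq0 msuppX. Qed.

(** Triangularity: [sec1 j] ends at coordinate j+1 with a power of T1, and those of smaller index
    vanish there. *)
Lemma sec_free n (l : nat -> S) :
  (forall k, (k < n.+1)%N -> \sum_(j < n) l j * sec1 j k = 0) ->
  forall j, (j < n)%N -> l j = 0.
Proof.
elim: n => [//|n IH] E.
have ln0 : l n = 0.
  have := E n.+1 (ltnSn _); rewrite big_ord_recr /= big1 ?add0r.
    rewrite (sec_top n).1 => /eqP; rewrite mulf_eq0 expf_eq0 (negbTE (T1_neq0)) andbF orbF.
    by move/eqP.
  by move=> j _; have jn := ltn_ord j; have [|-> _] := @sec_above j n.+1; rewrite ?mulr0.
move=> j; rewrite ltnS leq_eqVlt => /predU1P[-> //|lt_j]; apply: IH lt_j => k lt_k.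
by have := E k (ltnW lt_k); rewrite big_ord_recr /= ln0 mul0r addr0.
Qed.

End Tower.

(** * Bidegrees and the maximal ideal *)

Section Bigraded.
Variable K : fieldType.
Local Notation S := {mpoly K[5]}.
Implicit Types (a c : int * int) (x y : S).

Lemma bidegD m m' : bideg (m + m') = bideg m + bideg m'.
Proof.
have pairD (w x y z : int) : (w, x) + (y, z) = (w + y, x + z) by [].
by rewrite /bideg !mnmDE pairD; congr (_, _); lia.
Qed.

Lemma bihomog0 a : bihomog a (0 : S).
Proof. by move=> m; rewrite msupp0. Qed.

Lemma bihomogD a x y : bihomog a x -> bihomog a y -> bihomog a (x + y).
Proof. by move=> hx hy m /msuppD_le; rewrite mem_cat => /orP[/hx|/hy]. Qed.

Lemma bihomogN a x : bihomog a x -> bihomog a (- x).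
Proof. by move=> hx m; rewrite (perm_mem (msuppN _)); apply: hx. Qed.

Lemma bihomogB a x y : bihomog a x -> bihomog a y -> bihomog a (x - y).
Proof. by move=> hx hy; apply: bihomogD => //; apply: bihomogN. Qed.

Lemma bihomog_sum a (I : Type) (r : seq I) (F : I -> S) :
  (forall i, bihomog a (F i)) -> bihomog a (\sum_(i <- r) F i).
Proof.
move=> h; elim/big_ind: _ => //; [exact: bihomog0 | exact: bihomogD].
Qed.

Lemma bihomogM a c x y : bihomog a x -> bihomog c y -> bihomog (a + c) (x * y).
Proof.
move=> hx hy m /msuppM_le /allpairsP[[m1 m2] /= [/hx <- /hy <- ->]].
exact: bidegD.
Qed.

Lemma bihomogX m : bihomog (bideg m) ('X_[m] : S).
Proof. by move=> m'; rewrite msuppX inE => /eqP ->. Qed.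

Lemma bihomog_mulrb a x (e : bool) : (e -> bihomog a x) -> bihomog a (x *+ e).
Proof. by case: e => [/(_ isT)|_] //=; apply: bihomog0. Qed.

Lemma bihomogT0 e : bihomog (e%:Z, 0) ('X_iT0 ^+ e : S).
Proof.
rewrite mpolyXn; suff -> : (e%:Z, 0) = bideg (U_(iT0) *+ e) by apply: bihomogX.
by rewrite /bideg !mulmnE !mnm1E /= !mul0n mul1n addn0.
Qed.

Lemma bihomogT1 e : bihomog (e%:Z, 0) ('X_iT1 ^+ e : S).
Proof.
rewrite mpolyXn; suff -> : (e%:Z, 0) = bideg (U_(iT1) *+ e) by apply: bihomogX.
by rewrite /bideg !mulmnE !mnm1E /= !mul0n mul1n add0n.
Qed.

Lemma graded_mulmxr r s (er : 'I_r -> int * int) (es : 'I_s -> int * int)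
    (M : 'M[S]_(r, s)) : (forall i j, bihomog (er i - es j) (M i j)) ->
  graded (free_bihomog er) (free_bihomog es) (mulmxr M : 'rV_r -> 'rV_s).
Proof.
move=> hM a v hv j; rewrite mxE; apply: bihomog_sum => i.
have -> : a - es j = (a - er i) + (er i - es j) by rewrite addrA subrK.
exact: bihomogM.
Qed.

Lemma mcoeff0M x y : (x * y)@_0 = x@_0 * y@_0.
Proof. exact: (rmorphM (mcoeff 0%MM)). Qed.

(** This reduces minimality of the resolution to vanishing constant terms of the matrix entries. *)
Lemma maxSP x : maxS x <-> x@_0 = 0.
Proof.
split=> [[n [c [g [gX ->]]]]|x0].
  rewrite raddf_sum big1 //= => i _; have [j ->] := gX i.
  by rewrite mcoeff0M mcoeffX mnm1_eq0 mulr0.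
rewrite [x]mpolyE big_seq; apply: ideal_gen_sum => m mx.
have [i mi] : exists i, m i != 0%N.
  apply/existsP; apply: contraTT mx; rewrite negb_exists => /forallP m0.
  have -> : m = 0%MM by apply/mnmP => i; rewrite mnm0E; apply/eqP; rewrite -[_ == _]negbK m0.
  by rewrite -mcoeff_eq0 x0.
rewrite -[m in 'X_[m]](submK (m := U_(i)%MM) (m' := m)) ?lep1mP //.
rewrite mpolyXD scalerAl; apply/ideal_genM/ideal_gen_mem; by exists i.
Qed.

End Bigraded.

(** * The resolution in matrix form: exactness, bigrading, minimality *)

Definition lincomb (A : comNzRingType) r (F : 'I_r -> A) (v : 'rV[A]_r) : A^o :=
  \sum_i v 0 i * F i.

Lemma lincomb_is_linear (A : comNzRingType) r (F : 'I_r -> A) : linear (lincomb F).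
Proof.
move=> a v w; rewrite /lincomb scaler_sumr -big_split /=.
by apply: eq_bigr => i _; rewrite !mxE mulrDl -mulrA.
Qed.

HB.instance Definition _ (A : comNzRingType) r (F : 'I_r -> A) :=
  GRing.isLinear.Build A 'rV[A]_r A^o _ (lincomb F) (lincomb_is_linear F).

Lemma lincomb_delta (A : comNzRingType) r (F : 'I_r -> A) i : lincomb F (delta_mx 0 i) = F i.
Proof.
rewrite /lincomb (bigD1 i) //= mxE !eqxx mul1r big1 ?addr0 // => j ji.
by rewrite mxE (negbTE ji) andbF mul0r.
Qed.

Lemma lincomb_ideal (A : comNzRingType) r (F : 'I_r -> A) x :
  ideal_gen (subfam F setT) x <-> exists v, x = lincomb F v.
Proof.
split=> [[n [c [g [gF ->]]]]|[v ->]]; last first.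
  apply: ideal_gen_sum => i _; apply/ideal_genM/ideal_gen_mem.
  by exists i; rewrite ?inE.
elim/big_ind: _ => [|_ _ [v ->] [w ->]|i _]; first by exists 0; rewrite linear0.
- by exists (v + w); rewrite linearD.
- have [j _ ->] := gF i; exists (c i *: delta_mx 0 j).
  by rewrite linearZ /= lincomb_delta.
Qed.

(** Extension by 0 to all natural indices, to match the syzygies of a [tower], which are functions
    on nat. *)
Definition entry (A : nmodType) r (v : 'rV[A]_r) (k : nat) : A :=
  if insub k is Some i then v 0 i else 0.

Lemma entryE (A : nmodType) r (v : 'rV[A]_r) (i : 'I_r) : entry v i = v 0 i.
Proof. by rewrite /entry valK. Qed.

Section Resolution.
Variables (K : fieldType) (q' : nat).
Local Notation q := q'.+1.
Local Notation S := {mpoly K[5]}.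
Local Notation T0 := ('X_iT0 : S).
Local Notation T1 := ('X_iT1 : S).
Variables (b : nat -> nat) (A B : nat -> 'X_{1..5}) (iV iW o dg : nat -> nat).
Local Notation C := (binom K b A B).
Local Notation s1 := (syz1 K b B iV iW).
Local Notation s2 := (syz2 K b A iV iW).
Local Notation t1 := (sec1 K b A iV iW).
Local Notation t2 := (sec2 K b B iV iW).
Hypothesis tw : tower K q b A B iV iW o dg.
Variable pos : 'I_q.+2 -> nat.
Hypothesis pos_inj : injective pos.
Hypothesis pos_lt : forall i, (pos i < q.+2)%N.

Variable F : 'I_q.+2 -> S.
Hypothesis FE : forall i, F i = C (pos i).
Variable deg_F : 'I_q.+2 -> int * int.
Hypothesis deg_FE : forall i, deg_F i = ((b (pos i))%:Z, (dg (pos i))%:Z).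

Let p : 'I_q.+2 -> 'I_q.+2 := fun i => Ordinal (pos_lt i).
Let p_bij : bijective p.
Proof. by apply: injF_bij => i j /(congr1 val) /= /pos_inj. Qed.

(** Both syzygies of step k have the same bidegree, read off their terms X^B C_V and X^A C_V, where
    A and B belong to iW k. *)
Definition deg_syz (r : 'I_(q + q)) : int * int :=
  let k : nat := match split r with inl k => k | inr k => k end in
  ((b (iV k))%:Z, (dg (iV k) + dg (iW k))%N%:Z).

(** Bidegree of the Koszul relation of the pair of step j+1, that is of the product C_V C_W. *)
Definition deg_sec (j : 'I_q') : int * int :=
  ((b (iV j.+1) + b (iW j.+1))%N%:Z, (dg (iV j.+1) + dg (iW j.+1))%N%:Z).

Definition syz_mx : 'M[S]_(q + q, q.+2) :=
  col_mx (\matrix_(k, i) s1 k (pos i)) (\matrix_(k, i) s2 k (pos i)).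

Definition sec_mx : 'M[S]_(q', q + q) :=
  row_mx (\matrix_(j, k) t1 j k) (\matrix_(j, k) t2 j k).

Lemma mul_syz_mx (v1 v2 : 'rV[S]_q) i :
  (row_mx v1 v2 *m syz_mx) 0 i =
  \sum_(k < q) (entry v1 k * s1 k (pos i) + entry v2 k * s2 k (pos i)).
Proof.
rewrite mul_row_col !mxE -big_split /=; apply: eq_bigr => k _.
by rewrite !mxE !entryE.
Qed.

Lemma mul_sec_mx (v : 'rV[S]_q') : v *m sec_mx =
  row_mx (\row_k \sum_(j < q') entry v j * t1 j k) (\row_k \sum_(j < q') entry v j * t2 j k).
Proof.
rewrite mul_mx_row; congr row_mx; apply/rowP => k; rewrite !mxE;
by apply: eq_bigr => j _; rewrite !mxE entryE.
Qed.

Lemma all_pos (P : nat -> Prop) : (forall i, P (pos i)) -> forall j, (j < q.+2)%N -> P j.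
Proof.
case: p_bij => p' _ p'K h j lt_j; have := h (p' (Ordinal lt_j)).
by rewrite -[pos _]/(val (p _)) p'K.
Qed.

Lemma lincomb_pos (g : nat -> S) :
  lincomb F (\row_i g (pos i)) = \sum_(j < q.+2) g j * C j.
Proof.
rewrite (reindex p) /=; last exact: onW_bij.
by apply: eq_bigr => i _; rewrite mxE FE.
Qed.

Lemma row_pos (v : 'rV[S]_q.+2) : exists g : nat -> S, v = \row_i g (pos i).
Proof.
case: p_bij => p' pK p'K; exists (fun j => entry (\row_i v 0 (p' i)) j).
by apply/rowP => i; rewrite mxE -[pos i]/(val (p i)) entryE mxE pK.
Qed.

Lemma exact_syz : exact (mulmxr syz_mx : 'rV_(q + q) -> _) (lincomb F).
Proof.
move=> v; split=> [|[w ->]].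
  have [g ->] := row_pos v; rewrite lincomb_pos => E.
  have [h1 [h2 gE]] := syz_span tw (ltnSn q') E.
  exists (row_mx (\row_k h1 k) (\row_k h2 k)); apply/rowP => i.
  rewrite mul_syz_mx mxE gE //; apply: eq_bigr => k _.
  by rewrite !entryE !mxE.
pose f j := \sum_(k < q) (entry (lsubmx w) k * s1 k j + entry (rsubmx w) k * s2 k j).
have -> : mulmxr syz_mx w = \row_i f (pos i).
  by rewrite -[w]hsubmxK; apply/rowP => i; rewrite /= mul_syz_mx mxE.
rewrite lincomb_pos /f.
under eq_bigr do rewrite mulr_suml.
rewrite exchange_big big1 //= => k _; have kq := ltn_ord k.
under eq_bigr do rewrite mulrDl -!mulrA.
by rewrite big_split /= -!mulr_sumr (syz1_C tw) // (syz2_C tw) // !mulr0 addr0.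
Qed.

Lemma exact_sec : exact (mulmxr sec_mx : 'rV_q' -> _) (mulmxr syz_mx : 'rV_(q + q) -> _).
Proof.
move=> v; split=> [|[w ->]] /=.
  rewrite -[v]hsubmxK => E.
  have [|l lP] := @sec_span _ _ _ _ _ _ _ _ _ tw q' (ltnSn q') (entry (lsubmx v)) (entry (rsubmx v)).
    apply: all_pos => i; have /rowP/(_ i) := E; rewrite mul_syz_mx => ->.
    by rewrite mxE.
  exists (\row_j l j); rewrite mul_sec_mx; congr row_mx; apply/rowP => k;
  rewrite [RHS]mxE -[LHS]entryE; [rewrite (lP k _).1 // | rewrite (lP k _).2 //];
  by apply: eq_bigr => j _; rewrite entryE mxE.
apply/rowP => i; rewrite mul_sec_mx mul_syz_mx mxE.
under eq_bigr do rewrite !entryE !mxE !mulr_suml -big_split /=.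
rewrite exchange_big big1 //= => j _; have jq := ltn_ord j.
under eq_bigr do rewrite -!mulrA -mulrDr.
by rewrite -mulr_sumr (sec_syz tw) ?mulr0.
Qed.

Lemma inj_sec : injective (mulmxr sec_mx : 'rV_q' -> _).
Proof.
move=> v w /= /eqP; rewrite -subr_eq0 -mulmxBl => /eqP; rewrite mul_sec_mx => E.
apply/eqP; rewrite -subr_eq0; apply/eqP/rowP => j; rewrite -entryE [RHS]mxE.
apply: (sec_free tw (n := q') (l := entry (v - w))); last exact: ltn_ord.
move=> k lt_k; move/(congr1 lsubmx)/rowP/(_ (Ordinal lt_k)): E.
by rewrite row_mxKl !mxE /= => ->.
Qed.

Let hA i : bihomog (0, (dg i)%:Z) ('X_[A i] : S).
Proof. by rewrite -(tw_A tw); apply: bihomogX. Qed.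

Let hB i : bihomog (0, (dg i)%:Z) ('X_[B i] : S).
Proof. by rewrite -(tw_B tw); apply: bihomogX. Qed.

Let pairD (w x y z : int) : (w, x) + (y, z) = (w + y, x + z).
Proof. by []. Qed.

Let pairB (w x y z : int) : (w, x) - (y, z) = (w - y, x - z).
Proof. by []. Qed.

Let dgD k : (k < q)%N -> dg k.+2 = (dg (iV k) + dg (iW k))%N.
Proof.
move=> kq; have := bidegD (A (iV k)) (B (iW k)).
by rewrite -(tw_AD tw) // !(tw_A tw) (tw_B tw) pairD => -[]; lia.
Qed.

Let bihomog_eq a a' (x : S) : bihomog a' x -> a = a' -> bihomog a x.
Proof. by move=> h ->. Qed.

Lemma graded_F : graded (free_bihomog deg_F) (@bihomog K) (lincomb F).
Proof.
move=> a v hv; apply: bihomog_sum => i.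
have hF : bihomog (deg_F i) (F i).
  rewrite deg_FE FE; apply: bihomogB.
    apply: bihomog_eq; first by apply: bihomogM; [apply: bihomogT0|apply: hA].
    by rewrite pairD addr0 add0r.
  apply: bihomog_eq; first by apply: bihomogM; [apply: bihomogT1|apply: hB].
  by rewrite pairD addr0 add0r.
by have := bihomogM (hv i) hF; rewrite subrK.
Qed.

Lemma graded_syz :
  graded (free_bihomog deg_syz) (free_bihomog deg_F) (mulmxr syz_mx : 'rV_(q + q) -> 'rV_q.+2).
Proof.
apply: graded_mulmxr => r i; rewrite /deg_syz deg_FE /syz_mx mxE.
case: (split r) => k; rewrite mxE; have kq := ltn_ord k;
have /andP[_ bWV] := tw_bW tw kq; have eb := tw_bD tw kq; have ed := dgD kq;
(apply: bihomogD; first apply: bihomogB); apply: bihomog_mulrb => /eqP ->; rewrite pairB.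
- by apply: bihomog_eq; first apply: bihomogT0; congr (_, _); lia.
- by apply: bihomog_eq; first apply: hB; congr (_, _); lia.
- apply: bihomog_eq; first by apply: bihomogM; [apply: bihomogT1|apply: hB].
  by rewrite pairD; congr (_, _); lia.
- by apply: bihomog_eq; first apply: bihomogT1; congr (_, _); lia.
- by apply: bihomog_eq; first apply: hA; congr (_, _); lia.
- apply: bihomog_eq; first by apply: bihomogM; [apply: bihomogT0|apply: hA].
  by rewrite pairD; congr (_, _); lia.
Qed.

Let bihomog_eps a k (x : S) : bihomog a x -> bihomog a (eps K iV k * x).
Proof. by rewrite /eps => h; case: ifP => _; rewrite ?mul1r // mulN1r; apply: bihomogN. Qed.

Lemma graded_sec :
  graded (free_bihomog deg_sec) (free_bihomog deg_syz) (mulmxr sec_mx : 'rV_q' -> 'rV_(q + q)).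
Proof.
apply: graded_mulmxr => j r; rewrite /deg_syz /deg_sec /sec_mx mxE.
have jq := ltn_ord j; rewrite -ltnS in jq.
have /andP[_ bWV] := tw_bW tw (ltnW jq); have eb := tw_bD tw (ltnW jq).
have ed := dgD (ltnW jq); have := tw_newest tw jq; rewrite (tw_oS tw) // => new.
case: (split r) => k; rewrite mxE.
  apply: bihomogB; apply: bihomog_mulrb => /eqP ->; rewrite pairB.
    by apply: bihomog_eq; first apply: bihomogT1; congr (_, _); lia.
  apply: bihomog_eps; apply: bihomog_eq; first apply: hA.
  by case: new => -[-> ->]; congr (_, _); lia.
apply: bihomogD; apply: bihomog_mulrb => /eqP ->; rewrite pairB.
  apply: bihomog_eq; first by apply: bihomogN; apply: bihomogT0.
  by congr (_, _); lia.
apply: bihomog_eps; apply: bihomog_eq; first apply: hB.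
by case: new => -[-> ->]; congr (_, _); lia.
Qed.

Let maxT0 e : (0 < e)%N -> ('X_iT0 ^+ e : S)@_0 = 0.
Proof. by case: e => // e _; rewrite exprS mcoeff0M mcoeffX mnm1_eq0 mul0r. Qed.

Let maxT1 e : (0 < e)%N -> ('X_iT1 ^+ e : S)@_0 = 0.
Proof. by case: e => // e _; rewrite exprS mcoeff0M mcoeffX mnm1_eq0 mul0r. Qed.

Let maxA i : ('X_[A i] : S)@_0 = 0.
Proof.
rewrite mcoeffX; case: eqP => // E.
by have := tw_A tw i; rewrite E /bideg !mnm0E => -[]; have := tw_dg tw i; lia.
Qed.

Let maxB i : ('X_[B i] : S)@_0 = 0.
Proof.
rewrite mcoeffX; case: eqP => // E.
by have := tw_B tw i; rewrite E /bideg !mnm0E => -[]; have := tw_dg tw i; lia.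
Qed.

Lemma max_F i : (F i)@_0 = 0.
Proof. by rewrite FE /binom mcoeffB !mcoeff0M maxA maxB !mulr0 subr0. Qed.

Lemma max_syz k i : (k < q)%N -> (s1 k i)@_0 = 0 /\ (s2 k i)@_0 = 0.
Proof.
move=> kq; have /andP[bW _] := tw_bW tw kq; rewrite /syz1 /syz2.
by rewrite !(mcoeffD, mcoeffN, mcoeffMn, mcoeff0M) !(maxA, maxB) !mulr0 maxT0 ?maxT1 //
  !mul0rn ?oppr0 !addr0.
Qed.

Lemma max_sec j k : (j < q')%N -> (t1 j k)@_0 = 0 /\ (t2 j k)@_0 = 0.
Proof.
rewrite -ltnS => jq; have /andP[bW _] := tw_bW tw jq; rewrite /sec1 /sec2.
by rewrite !(mcoeffD, mcoeffN, mcoeffMn, mcoeff0M) !(maxA, maxB) !mulr0 maxT0 ?maxT1 //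
  ?oppr0 !mul0rn ?oppr0 !addr0.
Qed.

Lemma mul_max r s (M : 'M[S]_(r, s)) (v : 'rV_r) j :
  (forall i, (M i j)@_0 = 0) -> maxS ((v *m M) 0 j).
Proof.
move=> hM; apply/maxSP; rewrite mxE raddf_sum big1 //= => i _.
by rewrite mcoeff0M hM mulr0.
Qed.

Lemma max_syz_mx r i : (syz_mx r i)@_0 = 0.
Proof.
by rewrite /syz_mx mxE; case: (split r) => k; rewrite mxE;
  have [h1 h2] := max_syz (pos i) (ltn_ord k).
Qed.

Lemma max_sec_mx j r : (sec_mx j r)@_0 = 0.
Proof.
by rewrite /sec_mx mxE; case: (split r) => k; rewrite mxE;
  have [h1 h2] := max_sec k (ltn_ord j).
Qed.

Section Rees.
Variables u d : nat.
Hypothesis kerE : forall x, kerPhi0 u d x <-> ideal_gen (subfam F setT) x.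
Hypothesis onto : forall y, Rees u d y <-> exists x : S, y = Phi0 u d x.
Hypothesis graded0 : graded (@bihomog K) (@bihomogZ K d) (@Phi0 K u d).

Lemma tower_resolution :
  min_bigraded_resolution u d deg_F deg_syz deg_sec
    (lincomb F : {linear 'rV[S]_q.+2 -> S^o})
    (mulmxr syz_mx : {linear 'rV[S]_(q + q) -> 'rV[S]_q.+2})
    (mulmxr sec_mx : {linear 'rV[S]_q' -> 'rV[S]_(q + q)}).
Proof.
split=> //; [exact: inj_sec|exact: exact_sec|exact: exact_syz| |exact: graded_sec
  |exact: graded_syz|exact: graded_F| | | ].
- move=> x; rewrite -lincomb_ideal; exact: kerE.
- by move=> v i; apply: mul_max => j; apply: max_sec_mx.
- by move=> v i; apply: mul_max => j; apply: max_syz_mx.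
- move=> v; apply/maxSP; rewrite /lincomb raddf_sum big1 //= => i _.
  by rewrite mcoeff0M max_F mulr0.
Qed.

(* If F_i were redundant, a syzygy would have a coefficient equal to 1. *)
Lemma tower_minimal : minimal_generators F (@kerPhi0 K u d).
Proof.
split=> [x|J /properP[_ [i _ iJ]] genJ]; first exact: kerE.
have /genJ[n [c [g [gJ E]]]] : kerPhi0 u d (F i).
  by apply/kerE/ideal_gen_mem; exists i; rewrite ?inE.
have [v [vi EF]] : exists v : 'rV[S]_q.+2, v 0 i = 0 /\ F i = lincomb F v.
  rewrite E; elim/big_ind: _ => [|_ _ [v [vi ->]] [w [wi ->]]|j _].
  - by exists 0; rewrite linear0 mxE.
  - by exists (v + w); rewrite linearD mxE vi wi addr0.
  - have [j' j'J ->] := gJ j; exists (c j *: delta_mx 0 j').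
    rewrite linearZ /= lincomb_delta !mxE; split=> //.
    by rewrite eqxx; case: eqP j'J => [<-|]; rewrite ?mulr0 // (negbTE iJ).
have /exact_syz[w /rowP/(_ i) /= Ew] : lincomb F (v - delta_mx 0 i) = 0.
  by rewrite linearB /= lincomb_delta -EF subrr.
have : maxS ((v - delta_mx 0 i) 0 i) by rewrite Ew; apply: mul_max => r; apply: max_syz_mx.
move/maxSP/eqP; rewrite !mxE !eqxx vi.
by rewrite sub0r mcoeffN mcoeff1 eqxx oppr_eq0 oner_eq0.
Qed.
End Rees.

End Resolution.

(** * Toric kernels *)
Section Fibres.
Variables (K : fieldType) (n : nat).
Local Notation S := {mpoly K[n]}.

(** Replacing every monomial by a fixed representative of its fibre changes x only by an element of
    the ideal, and the result is 0 because the coefficients of each fibre add up to 0. *)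
Lemma fibre_span (T : eqType) (f : 'X_{1..n} -> T) (P : S -> Prop) (x : S) :
  (forall v, \sum_(m <- msupp x | f m == v) x@_m = 0) ->
  (forall m m', f m = f m' -> ideal_gen P ('X_[m] - 'X_[m'])) ->
  ideal_gen P x.
Proof.
move=> fib0 PX.
pose rep m := head m [seq m' <- msupp x | f m' == f m].
have repP m : m \in msupp x -> f (rep m) = f m.
  move=> mx; have: m \in [seq m' <- msupp x | f m' == f m] by rewrite mem_filter eqxx.
  rewrite /rep; case E : [seq _ <- _ | _] => [//|m' s] _ /=; apply/eqP.
  have: m' \in [seq m' <- msupp x | f m' == f m] by rewrite E mem_head.
  by rewrite mem_filter => /andP[].
have rep_eq m m' : m \in msupp x -> f m = f m' -> rep m = rep m'.
  move=> mx E; have: m \in [seq m' <- msupp x | f m' == f m] by rewrite mem_filter eqxx.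
  by rewrite /rep E; case: [seq _ <- _ | _].
have rep0 : \sum_(m <- msupp x) x@_m *: 'X_[rep m] = 0 :> S.
  apply/mpolyP => k; rewrite raddf_sum mcoeff0 /=.
  under eq_bigr do rewrite mcoeffZ mcoeffX mulr_natr mulrb.
  rewrite -big_mkcond /=.
  have [/hasP[m1 m1x /eqP rm1]|/hasPn no] := boolP (has (fun m => rep m == k) (msupp x)).
    rewrite -[RHS](fib0 (f m1)) big_seq_cond [RHS]big_seq_cond; apply: eq_bigl => m.
    case mx : (m \in msupp x) => //=; apply/eqP/eqP => [rm|]; last by move/(rep_eq _ _ mx) ->.
    by rewrite -(repP _ mx) rm -rm1 repP.
  by rewrite big_seq_cond big_pred0 // => m; apply/negP => /andP[/no /negbTE ->].
have -> : x = \sum_(m <- msupp x) (x@_m *: 'X_[m] - x@_m *: 'X_[rep m]).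
  by rewrite sumrB rep0 subr0 -mpolyE.
rewrite big_seq.
apply: ideal_gen_sum => m mx; rewrite -scalerBr -mul_mpolyC; apply/ideal_genM/PX.
by rewrite repP.
Qed.

(** A fibre meeting the support only in m would have coefficient sum x@_m, which is nonzero. *)
Lemma fibre_partner (T : eqType) (f : 'X_{1..n} -> T) (x : S) m :
  (forall v, \sum_(m <- msupp x | f m == v) x@_m = 0) -> m \in msupp x ->
  exists m', [/\ m' \in msupp x, m' != m & f m' = f m].
Proof.
move=> fib0 mx.
have [/hasP[m' m'x /andP[ne /eqP fE]]|/hasPn no] :=
  boolP (has (fun m' => (m' != m) && (f m' == f m)) (msupp x)); first by exists m'.
have := fib0 (f m); rewrite (big_rem m) //= eqxx big_seq_cond big_pred0 ?addr0.
  by move/eqP; rewrite mcoeff_eq0 mx.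
move=> m'; apply/negP; rewrite mem_rem_uniq // => /andP[/andP[/= ne m'x] fE].
by have := no _ m'x; rewrite ne fE.
Qed.

Lemma ideal_binom_pow (P : S -> Prop) w m m' k :
  ideal_gen P ('X_[m] - 'X_[m']) -> ideal_gen P ('X_[w + m *+ k] - 'X_[w + m' *+ k]).
Proof.
move=> h; rewrite !mpolyXD -!mpolyXn -mulrBr subrXX; apply/ideal_genM.
by rewrite mulrC; apply/ideal_genM.
Qed.

Lemma binom_neq0 m m' : m != m' -> 'X_[m] - 'X_[m'] != 0 :> S.
Proof.
move=> ne; apply/eqP => /(congr1 (mcoeff m)) /eqP.
by rewrite mcoeffB !mcoeffX eqxx [m' == m]eq_sym (negbTE ne) subr0 mcoeff0 oner_eq0.
Qed.

End Fibres.

Lemma prod5 (A : comNzRingType) (F : 'I_5 -> A) :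
  \prod_i F i = F iT0 * F iT1 * F iX0 * F iX1 * F iX2.
Proof.
rewrite !big_ord_recr big_ord0 /= mul1r.
by congr (_ * _ * _ * _ * _); congr F; apply: val_inj.
Qed.

Lemma mnm5P (m m' : 'X_{1..5}) : m iT0 = m' iT0 -> m iT1 = m' iT1 ->
  m iX0 = m' iX0 -> m iX1 = m' iX1 -> m iX2 = m' iX2 -> m = m'.
Proof.
move=> h0 h1 h2 h3 h4; apply/mnmP => i.
have E j : val i = val j -> m j = m' j -> m i = m' i by move=> /val_inj ->.
by case: i E => -[|[|[|[|[|//]]]]] ? E;
  [apply: E h0|apply: E h1|apply: E h2|apply: E h3|apply: E h4].
Qed.

Lemma mnm5_le (m m' : 'X_{1..5}) :
  (m iT0 <= m' iT0)%N -> (m iT1 <= m' iT1)%N -> (m iX0 <= m' iX0)%N ->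
  (m iX1 <= m' iX1)%N -> (m iX2 <= m' iX2)%N -> (m <= m')%MM.
Proof.
move=> h0 h1 h2 h3 h4; apply/mnm_lepP => i.
have E j : val i = val j -> (m j <= m' j)%N -> (m i <= m' i)%N by move=> /val_inj ->.
by case: i E => -[|[|[|[|[|//]]]]] ? E;
  [apply: E h0|apply: E h1|apply: E h2|apply: E h3|apply: E h4].
Qed.

Lemma mnm2P (m m' : 'X_{1..2}) : m rT0 = m' rT0 -> m rT1 = m' rT1 -> m = m'.
Proof.
move=> h0 h1; apply/mnmP => i.
have E j : val i = val j -> m j = m' j -> m i = m' i by move=> /val_inj ->.
by case: i E => -[|[|//]] ? E; [apply: E h0|apply: E h1].
Qed.

Section Phi0.
Variables (K : fieldType) (u d : nat).
Local Notation S := {mpoly K[5]}.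

Definition Zdeg (m : 'X_{1..5}) := (m iX0 + m iX1 + m iX2)%N.

Definition Tmon (m : 'X_{1..5}) : 'X_{1..2} :=
  (U_(rT0) *+ (m iT0 + d * m iX0 + (d - u) * m iX1)
   + U_(rT1) *+ (m iT1 + u * m iX1 + d * m iX2))%MM.

Definition fibre m := (Zdeg m, Tmon m).

Lemma Tmon0 m : Tmon m rT0 = (m iT0 + d * m iX0 + (d - u) * m iX1)%N.
Proof. by rewrite mnmDE !mulmnE !mnm1E /= mul1n mul0n addn0. Qed.

Lemma Tmon1 m : Tmon m rT1 = (m iT1 + u * m iX1 + d * m iX2)%N.
Proof. by rewrite mnmDE !mulmnE !mnm1E /= mul1n mul0n add0n. Qed.

Lemma Phi0X m : Phi0 u d ('X_[m] : S) = ('X_[Tmon m])%:P * 'X^(Zdeg m).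
Proof.
have monE (A : comNzRingType) (a b z : A) (m0 m1 m2 m3 m4 : nat) :
    a ^+ m0 * b ^+ m1 * (z * a ^+ d) ^+ m2 * (z * (a ^+ (d - u) * b ^+ u)) ^+ m3
      * (z * b ^+ d) ^+ m4 =
    a ^+ (m0 + d * m2 + (d - u) * m3) * b ^+ (m1 + u * m3 + d * m4)
      * z ^+ (m2 + m3 + m4).
  by rewrite !exprMn !exprD !exprM; ring.
rewrite [LHS]mmapX /mmap1 prod5 /Phi0_var /= polyCM !(rmorphXn polyC) /= monE.
by rewrite /Tmon /Zdeg mpolyXD polyCM -!mpolyXn !(rmorphXn polyC).
Qed.

Lemma Phi0E (x : S) : Phi0 u d x =
  \sum_(m <- msupp x) (x@_m)%:MP%:P * (('X_[Tmon m])%:P * 'X^(Zdeg m)).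
Proof. by apply: eq_bigr => m _; rewrite -Phi0X /Phi0 mmapX. Qed.

Lemma coef_Phi0 (x : S) n v :
  ((Phi0 u d x)`_n)@_v = \sum_(m <- msupp x | fibre m == (n, v)) x@_m.
Proof.
rewrite Phi0E coef_sum raddf_sum [RHS]big_mkcond /=; apply: eq_bigr => m _.
rewrite !coefCM coefXn mcoeffCM mulr_natr mcoeffMn mcoeffX -mulrnA mulr_natr mulnb.
by rewrite xpair_eqE [n == _]eq_sym andbC mulrb.
Qed.

(** [Phi0] sends monomials to monomials, so cancellation takes place separately inside each
    fibre. *)
Lemma kerPhi0P (x : S) :
  kerPhi0 u d x <-> forall v, \sum_(m <- msupp x | fibre m == v) x@_m = 0.
Proof.
split=> [x0 [n v]|fib0]; first by rewrite -coef_Phi0 x0 coef0 mcoeff0.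
by apply/polyP => n; apply/mpolyP => v; rewrite coef_Phi0 fib0 coef0 mcoeff0.
Qed.

End Phi0.

(** * The initial complete intersection *)

Section BaseSyzygy.
Variables (K : fieldType) (u e : nat).
Hypothesis (u_gt0 : (0 < u)%N).
Local Notation S := {mpoly K[5]}.
Local Notation T0 := ('X_iT0 : S).
Local Notation T1 := ('X_iT1 : S).

(** The ideal of P is the kernel of a substitution into a domain (by [fibre_span] applied to [psi]),
    and N survives the substitution; hence g * N in (P) forces g in (P). *)
Lemma base_syzygy (N P g h : S) :
  N = T0 ^+ e * 'X_iX2 - T1 ^+ e * 'X_iX1 -> P = T0 ^+ u * 'X_iX1 - T1 ^+ u * 'X_iX0 ->
  g * N + h * P = 0 -> exists l, g = l * P /\ h = - l * N.
Proof.
move=> NE PE E.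
have {}PE : P = 'X_[U_(iT0) *+ u + U_(iX1)] - 'X_[U_(iT1) *+ u + U_(iX0)].
  by rewrite PE !mpolyXn -!mpolyXD.
have {}NE : N = 'X_[U_(iT0) *+ e + U_(iX2)] - 'X_[U_(iT1) *+ e + U_(iX1)].
  by rewrite NE !mpolyXn -!mpolyXD.
have P0 : P != 0.
  rewrite PE binom_neq0 //; apply/eqP => /mnmP/(_ iX0).
  by rewrite !mnmDE !mulmnE !mnm1E.
suff [l gE] : exists l, g = l * P.
  exists l; split=> //; apply: (mulIf P0); apply/eqP; rewrite -subr_eq0 -E gE; apply/eqP; ring.
(* X0, X1 |-> T0^u X0, T1^u X0 kills P but not N. *)
pose t : 5.-tuple S := [tuple 'X_iT0; 'X_iT1; T0 ^+ u * 'X_iX0; T1 ^+ u * 'X_iX0; 'X_iX2].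
pose psi (m : 'X_{1..5}) : 'X_{1..5} := (U_(iT0) *+ (m iT0 + u * m iX0)
   + U_(iT1) *+ (m iT1 + u * m iX1) + U_(iX0) *+ (m iX0 + m iX1) + U_(iX2) *+ m iX2)%MM.
have psiX m : 'X_[m] \mPo t = 'X_[psi m].
  rewrite comp_mpolyX prod5 !(tnth_nth 0) /=.
  rewrite !mpolyXD -!mpolyXn !exprD !exprM !exprMn; ring.
have gpsi0 : g \mPo t = 0.
  have Pt : P \mPo t = 0.
    rewrite PE comp_mpolyB !psiX; apply/eqP; rewrite subr_eq0; apply/eqP; congr 'X_[_].
    by apply: mnm5P; rewrite /psi !(mnmDE, mulmnE, mnm1E) /=; lia.
  have Nt : N \mPo t != 0.
    rewrite NE comp_mpolyB !psiX binom_neq0 //; apply/eqP => /mnmP/(_ iX2).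
    by rewrite /psi !(mnmDE, mulmnE, mnm1E).
  have := congr1 (comp_mpoly t) E; rewrite comp_mpolyD !rmorphM /= Pt mulr0 addr0.
  by rewrite comp_mpoly0 => /eqP; rewrite mulf_eq0 (negbTE Nt) orbF => /eqP.
have : ideal_gen (fun y => y = P) g.
  apply: (fibre_span (f := psi)) => [v|m m' /mnmP psiE].
    transitivity ((g \mPo t)@_v); last by rewrite gpsi0 mcoeff0.
    rewrite comp_mpolyEX raddf_sum big_mkcond /=; apply: eq_bigr => m _.
    by rewrite psiX mcoeffZ mcoeffX mulr_natr mulrb.
  have := psiE iT0; have := psiE iT1; have := psiE iX0; have := psiE iX2.
  rewrite !mnmDE !mulmnE !mnm1E /= !mul0n !mul1n !addn0 !add0n => E4 E2 E1 E0.
  wlog le : m m' psiE E4 E2 E1 E0 / (m' iX0 <= m iX0)%N.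
    move=> W; have [|/ltnW] := leqP (m' iX0) (m iX0); first exact: W.
    by move=> /W h'; rewrite -opprB; apply/ideal_genN/h'.
  have [k kE] : exists k, m iX0 = (m' iX0 + k)%N by exists (m iX0 - m' iX0)%N; lia.
  have kE1 : m' iX1 = (m iX1 + k)%N by lia.
  rewrite kE kE1 !mulnDr in E0 E1.
  pose w := (m - (U_(iT1) *+ u + U_(iX0)) *+ k)%MM.
  have -> : m = (w + (U_(iT1) *+ u + U_(iX0)) *+ k)%MM.
    by apply: mnm5P; rewrite !mnmDE !mnmBE !mulmnE !mnmDE !mulmnE !mnm1E /=; lia.
  have -> : m' = (w + (U_(iT0) *+ u + U_(iX1)) *+ k)%MM.
    by apply: mnm5P; rewrite !mnmDE !mnmBE !mulmnE !mnmDE !mulmnE !mnm1E /=; lia.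
  by apply: ideal_binom_pow; rewrite -opprB -PE; apply/ideal_genN/ideal_gen_mem.
case=> n [c [f [fP ->]]]; exists (\sum_i c i); rewrite mulr_suml.
by apply: eq_bigr => i _; rewrite (fP i).
Qed.

End BaseSyzygy.

(** * The Rees algebra *)
Section ReesImage.
Variables (K : fieldType) (u d : nat).
Hypothesis le_ud : (u <= d)%N.
Local Notation S := {mpoly K[5]}.
Local Notation Phi0 := (@Phi0 K u d).

Lemma Phi0_graded : graded (@bihomog K) (@bihomogZ K d) Phi0.
Proof.
move=> a x hx n v; rewrite mcoeff_msupp coef_Phi0 => nz.
have [m mx /eqP[<- <-]] : exists2 m, m \in msupp x & fibre u d m == (n, v).
  apply/hasP; apply: contraNT nz => /hasPn no.
  by rewrite big_seq_cond big_pred0 // => m; apply/negP => /andP[/no /negbTE ->].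
have mdeg2 (k : 'X_{1..2}) : mdeg k = (k rT0 + k rT1)%N.
  by rewrite mdegE !big_ord_recr big_ord0 /=; congr (k _ + k _)%N; apply: val_inj.
rewrite -(hx _ mx) mdeg2 Tmon0 Tmon1 /bideg /Zdeg; congr (_, _).
have : ((d - u) * m iX1 + u * m iX1 = d * m iX1)%N by rewrite -mulnDl subnK.
rewrite !mulnDr; move: ((d - u) * m iX1)%N (u * m iX1)%N (d * m iX1)%N => x1 x2 x3.
by move: (d * m iX0)%N (d * m iX2)%N => x4 x5; lia.
Qed.

Let im y := exists x, y = Phi0 x.

Let imD y z : im y -> im z -> im (y + z).
Proof. by move=> [v ->] [w ->]; exists (v + w); rewrite /Defs.Phi0 mmapD. Qed.

Let imM y z : im y -> im z -> im (y * z).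
Proof. by move=> [v ->] [w ->]; exists (v * w); rewrite /Defs.Phi0 rmorphM. Qed.

Let im0 : im 0.
Proof. by exists 0; rewrite /Defs.Phi0 mmap0. Qed.

Let im1 : im 1.
Proof. by exists 1; rewrite /Defs.Phi0 rmorph1. Qed.

Let imXn y n : im y -> im (y ^+ n).
Proof. by move=> hy; elim: n => [|n IH]; rewrite ?expr0 // exprS; apply: imM. Qed.

Let im_sum (I : Type) (r : seq I) (P : pred I) F :
  (forall i, P i -> im (F i)) -> im (\sum_(i <- r | P i) F i).
Proof. by move=> h; elim/big_ind: _. Qed.

Let im_var i : im (Phi0_var K u d i).
Proof. by exists 'X_i; rewrite /Defs.Phi0 mmapX mmap1U. Qed.

Let imC (c : {mpoly K[2]}) : im c%:P.
Proof.
rewrite [c]mpolyE raddf_sum /=; apply: im_sum => m _.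
rewrite -mul_mpolyC polyCM; apply: imM; first by exists (c@_m)%:MP; rewrite /Defs.Phi0 mmapC.
rewrite mpolyXE_id rmorph_prod /=.
elim/big_ind: _ => [|y z|i _]; [exact: im1|exact: imM|].
rewrite rmorphXn; apply: imXn.
have [->|->] : i = rT0 \/ i = rT1.
  by case: i => -[|[|//]] ?; [left|right]; apply: val_inj.
exact: (im_var iT0).
exact: (im_var iT1).
Qed.

Let im_monI (a : {mpoly K[2]}) : monI u d a -> im (a%:P * 'X).
Proof.
move=> [n [c [g [gI ->]]]]; rewrite raddf_sum mulr_suml /=; apply: im_sum => i _.
rewrite polyCM -mulrA; apply: imM; [exact: imC|rewrite mulrC].
case: (gI i) => ->; [exact: (im_var iX0)|exact: (im_var iX1)|exact: (im_var iX2)].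
Qed.

Lemma Phi0_onto y : Rees u d y <-> exists x, y = Phi0 x.
Proof.
split=> [yR|[x ->] n].
  rewrite -[y]coefK poly_def; apply: im_sum => n _.
  have [k [c [g [gI ->]]]] := yR n.
  rewrite -mul_polyC raddf_sum mulr_suml /=; apply: im_sum => i _.
  have [f [fI ->]] := gI i; rewrite polyCM -mulrA; apply: imM; first exact: imC.
  rewrite -[n in 'X^n]card_ord -prodr_const rmorph_prod -big_split /=.
  by elim/big_ind: _ => [|y1 y2|j _]; [exact: im1|exact: imM|exact: im_monI].
rewrite Phi0E coef_sum; apply: ideal_gen_sum => m _; rewrite !coefCM; apply: ideal_genM.
rewrite coefXn; case: eqP => [->|_]; last by rewrite mulr0; apply: ideal_gen0.
rewrite mulr1.
(* The Zdeg m factors that [ideal_pow] asks for, in three consecutive blocks of lengths given by the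
   exponents of X0, X1 and X2. *)
pose f (i : nat) : {mpoly K[2]} := if (i < m iX0)%N then 'X_rT0 ^+ d
  else if (i < m iX0 + m iX1)%N then 'X_rT0 ^+ (d - u) * 'X_rT1 ^+ u else 'X_rT1 ^+ d.
have -> : 'X_[Tmon u d m] =
    'X_rT0 ^+ m iT0 * 'X_rT1 ^+ m iT1 * \prod_(i < Zdeg m) f i.
  rewrite -(big_mkord predT f) /Zdeg.
  rewrite (big_cat_nat (n := m iX0 + m iX1)) ?leq_addr //=.
  rewrite (big_cat_nat (n := m iX0)) ?leq_addr //=.
  rewrite (eq_big_nat _ _ (F2 := fun=> 'X_rT0 ^+ d)); last first.
    by move=> i /andP[_ lt_i]; rewrite /f lt_i.
  rewrite [X in _ * (_ * X * _)](eq_big_nat _ _ (F2 := fun=> 'X_rT0 ^+ (d - u) * 'X_rT1 ^+ u)); last first.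
    by move=> i /andP[le_i lt_i]; rewrite /f ltnNge le_i lt_i.
  rewrite [X in _ * (_ * X)](eq_big_nat _ _ (F2 := fun=> 'X_rT1 ^+ d)); last first.
    move=> i /andP[le_i _]; rewrite /f ltnNge (leq_trans _ le_i) ?leq_addr //=.
    by rewrite ltnNge le_i.
  rewrite !prodr_const_nat subn0 ![(_ + _ - _)%N]addKn.
  by rewrite mpolyXD -!mpolyXn !exprD !exprM !exprMn; ring.
apply/ideal_genM/ideal_gen_mem; exists (fun i => f i); split=> // i.
apply: ideal_gen_mem; rewrite /f; case: ifP => _; first by constructor 1.
by case: ifP => _; [constructor 2|constructor 3].
Qed.

End ReesImage.

(** * The slow Euclidean sequence *)
Definition slow (p : nat * nat) : nat * nat :=
  if (p.2 <= p.1 - p.2)%N then ((p.1 - p.2)%N, p.2) else (p.2, (p.1 - p.2)%N).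

(** One Euclidean division with quotient k is k slow steps; the components are exchanged only at the
    last of them. *)
Lemma iter_slow k c r : (0 < k)%N -> (r < c)%N ->
  iter k slow ((k * c + r)%N, c) = (c, r) /\
  forall j, (j < k)%N -> iter j slow ((k * c + r)%N, c) = (((k - j) * c + r)%N, c).
Proof.
move=> k0 rc.
have mid j : (j < k)%N -> iter j slow ((k * c + r)%N, c) = (((k - j) * c + r)%N, c).
  elim: j => [|j IH] jk; first by rewrite subn0.
  rewrite iterS IH ?(ltnW jk) // /slow /=.
  have [e eE] : exists e, (k - j = e.+2)%N by exists (k - j.+2)%N; lia.
  have -> : (k - j.+1 = e.+1)%N by lia.
  by rewrite eE !mulSn -!addnA addKn leq_addr.
split=> //; case: k k0 mid => // k _ mid.
rewrite iterS mid // subSnn mul1n /slow /= addKn leqNgt rc //.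
Qed.

(** The gcd is invariant, so coprimality makes the pair after q steps (1, 0); its only possible
    predecessor with positive second component is (1, 1). *)
Lemma slow_euclid u d p (a k : nat -> nat) : gcdn u d = 1%N -> (0 < u)%N -> (2 * u < d)%N ->
  euclid_data u d p a k ->
  let q := (\sum_(1 <= i < p) k i)%N in
  let bc j := iter j slow ((d - u)%N, u) in
  [/\ (1 < q)%N, forall j, (j < q)%N -> (0 < (bc j).2 <= (bc j).1)%N
    & bc q.-1 = (1%N, 1%N)].
Proof.
move=> co u0 ud [a0 a1 ap Ha] q bc.
have p2 : (1 < p)%N by case: p ap {Ha q} => [|[|//]]; lia.
(* The slow sequence meets the pair (a_(i-1), a_i) after as many steps as the sum of the quotients
   of index below i. *)
have part i : (0 < i <= p)%N ->
    bc (\sum_(1 <= l < i) k l)%N = (a i.-1, a i) /\ (a i < a i.-1)%N /\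
    forall j, (j < \sum_(1 <= l < i) k l)%N -> (0 < (bc j).2)%N.
  elim: i => [//|[|i] IH] ip; first by rewrite big_nil /bc /= a0 a1; split=> //; split=> //; lia.
  have [bci [ai prev]] := IH (ltnW ip).
  have [|/= E lt] := Ha i.+1; first lia.
  have k0 : (0 < k i.+1)%N by move: E ai => /=; case: (k i.+1) => //; lia.
  have [fin mid] := iter_slow k0 lt.
  rewrite big_nat_recr //=; set s := (\sum_(1 <= l < i.+1) k l)%N in bci prev *.
  have bcD j : bc (s + j)%N = iter j slow (k i.+1 * a i.+1 + a i.+2, a i.+1)%N.
    by rewrite /bc addnC iterD -/(bc s) bci /= E.
  split; first by rewrite bcD.
  split=> // j js; have [/prev//|sj] := ltnP j s.
  by rewrite -(subnKC sj) bcD mid ?ltn_subLR //=; lia.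
have [|bcq [_ c0]] := part p; first lia.
rewrite -/q ap in bcq c0.
have gcd1 j : (forall l, (l < j)%N -> (0 < (bc l).2)%N) ->
    ((bc j).2 <= (bc j).1)%N /\ gcdn (bc j).1 (bc j).2 = 1%N.
  elim: j => [|j IH] h.
    rewrite /bc /=; split; first lia.
    by rewrite gcdnC -gcdnDr subnK //; lia.
  have [|le gcd] := IH; first by move=> l lj; apply: h; lia.
  have c := h j (ltnSn j).
  rewrite /bc iterS -/(bc j) /slow; case: (bc j) le gcd c => b c /= le gcd c1.
  have gcd' : gcdn (b - c) c = 1%N by rewrite gcdnC -gcdnDr subnK // gcdnC.
  by case: (leqP c (b - c)) => cb /=; rewrite ?(gcdnC c); split=> //; lia.
have q0 : (0 < q)%N by rewrite lt0n; apply/eqP => q0; move: bcq; rewrite q0 /bc /= => -[]; lia.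
have bcq1 : bc q = (1%N, 0%N).
  by have [_] := gcd1 _ c0; rewrite bcq /= gcdn0 => ->.
have bcq' : bc q.-1 = (1%N, 1%N).
  have := bcq1; rewrite -{1}(prednK q0) /bc iterS -/(bc _) /slow.
  have [|le _] := gcd1 q.-1; first by move=> l lq; apply: c0; lia.
  have := c0 q.-1; rewrite prednK // => /(_ (leqnn _)); move: le.
  by case: (bc _) => b c /= le c1; case: (leqP c (b - c)) => _ [] ? ?; congr (_, _); lia.
split=> // [|j jq]; last first.
  by rewrite c0 //; have [|->] := gcd1 j => // l lj; apply: c0; lia.
(* If q were 1, then (d - u, u) would be (1, 1), against 2u < d. *)
rewrite ltn_neqAle q0 andbT; apply/eqP => q1; move: bcq'; rewrite -q1 /bc /= => -[]; lia.
Qed.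

(* The data b, sigma, tau of one generator: gs tells whether sigma > 0, and
   gx = |sigma|, gy = |tau|. *)
Record gen := Gen { gb : nat; gs : bool; gx : nat; gy : nat }.

Definition gen_sigma g : int := if gs g then (gx g)%:Z else - (gx g)%:Z.
Definition gen_tau g : int := if gs g then - (gy g)%:Z else (gy g)%:Z.
Definition gdeg g := (gx g + gy g)%N.

Definition mon02 (x y : nat) : 'X_{1..5} := (U_(iX0) *+ x + U_(iX2) *+ y)%MM.
Definition mon1 (x : nat) : 'X_{1..5} := (U_(iX1) *+ x)%MM.
Definition genA g := if gs g then mon1 (gdeg g) else mon02 (gx g) (gy g).
Definition genB g := if gs g then mon02 (gx g) (gy g) else mon1 (gdeg g).

(** Meant for v and w of opposite types: subtracting (sigma, tau) then keeps the signs of v and adds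
    the absolute values. *)
Definition gdiff v w := Gen (gb v - gb w) (gs v) (gx v + gx w) (gy v + gy w).

Lemma genA_diff v w : gs w = ~~ gs v -> genA (gdiff v w) = (genA v + genB w)%MM.
Proof.
case: v w => [b s x y] [b' s' x' y'] /= ->.
by case: s; rewrite /genA /genB /gdeg /mon02 /mon1 /=; apply/mnmP => i;
  rewrite !(mnmDE, mulmnE); lia.
Qed.

Lemma genB_diff v w : gs w = ~~ gs v -> genB (gdiff v w) = (genB v + genA w)%MM.
Proof.
case: v w => [b s x y] [b' s' x' y'] /= ->.
by case: s; rewrite /genA /genB /gdeg /mon02 /mon1 /=; apply/mnmP => i;
  rewrite !(mnmDE, mulmnE); lia.
Qed.

Lemma bideg_genA g : bideg (genA g) = (0, (gdeg g)%:Z).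
Proof.
rewrite /genA /bideg /mon02 /mon1; case: ifP => _;
by congr (_, _); rewrite !(mnmDE, mulmnE, mnm1E) /= /gdeg; lia.
Qed.

Lemma bideg_genB g : bideg (genB g) = (0, (gdeg g)%:Z).
Proof.
rewrite /genB /bideg /mon02 /mon1; case: ifP => _;
by congr (_, _); rewrite !(mnmDE, mulmnE, mnm1E) /= /gdeg; lia.
Qed.

Section Slow.
Variables u d : nat.

Definition gen_step (p : gen * gen) :=
  let D := gdiff p.1 p.2 in
  if (gb p.2 <= gb D)%N then (D, p.2) else (p.2, D).

Definition slow_pair k := iter k gen_step (Gen (d - u) false 0 1, Gen u true 1 0).
Notation V k := (slow_pair k).1.
Notation W k := (slow_pair k).2.

Lemma slow_pairS k : slow_pair k.+1 = if (gb (W k) <= gb (gdiff (V k) (W k)))%N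
  then (gdiff (V k) (W k), W k) else (W k, gdiff (V k) (W k)).
Proof. by []. Qed.

Lemma slow_pair_type k : gs (W k) = ~~ gs (V k).
Proof. by elim: k => // k IH; rewrite slow_pairS; case: ifP => _ /=; rewrite IH ?negbK. Qed.

Lemma slow_pair_b k : (gb (V k), gb (W k)) = iter k slow ((d - u)%N, u).
Proof.
by elim: k => // k IH; rewrite iterS -IH slow_pairS /slow /=; case: ifP.
Qed.

Lemma slow_pair_sers k : sers u d k.+1 =
  SersState (gb (V k)) (gb (W k)) (gen_sigma (V k)) (gen_tau (V k))
    (gen_sigma (W k)) (gen_tau (W k)).
Proof.
elim: k => [//|k IH]; rewrite -[sers u d k.+2]/(sers_step (sers u d k.+1)) IH slow_pairS /=.
have := slow_pair_type k; case: (slow_pair k) => -[b s x y] [c t x' y'] /= ->.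
by rewrite /gen_sigma /gen_tau /=; case: ifP => _; case: s => /=; congr SersState; lia.
Qed.

(** The relation sigma u + tau (d-u) = b with its negative term moved next to b, together with the
    positivity of the coordinate on the other side. *)
Definition gen_ok g := if gs g then (0 < gx g)%N && (gb g + gy g * (d - u) == gx g * u)%N
  else (0 < gy g)%N && (gb g + gx g * u == gy g * (d - u))%N.

Lemma gen_ok_diff v w : (gb w <= gb v)%N -> gs w = ~~ gs v -> gen_ok v -> gen_ok w ->
  gen_ok (gdiff v w).
Proof.
case: v w => [b s x y] [c t x' y'] /= cb ->; rewrite /gen_ok /= => hv hw.
case: s hv hw => /= /andP[p1 /eqP e1] /andP[p2 /eqP e2];
by rewrite addn_gt0 p1 /=; apply/eqP; rewrite !mulnDl -?e1 -?e2; lia.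
Qed.

(** Determinant of the two (sigma, tau) equal to 1 or -1, written without subtraction: the pair is a
    basis of the lattice. *)
Definition det_ok v w :=
  if gs v then (gx v * gy w = gx w * gy v + 1)%N else (gx w * gy v = gx v * gy w + 1)%N.

Lemma det_slow_pair k : det_ok (V k) (W k).
Proof.
elim: k => [//|k IH]; rewrite slow_pairS.
have := slow_pair_type k; move: IH; case: (slow_pair k) => -[b s x y] [c t x' y'].
by rewrite /det_ok /=; case: (_ <= _)%N => /=; case: s => /= E Et; rewrite ?Et /= !mulnDl !mulnDr; lia.
Qed.

(** Creation numbers of V k and W k: 0 and 1 for the initial elements, k+2 for the one created at
    step k. *)
Fixpoint pair_index k : nat * nat := if k is k'.+1 then
  if (gb (W k') <= gb (gdiff (V k') (W k')))%N then (k'.+2, (pair_index k').2)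
  else ((pair_index k').2, k'.+2) else (0%N, 1%N).

Definition other k := if k is k'.+1 then (pair_index k').2 else 0%N.

Lemma pair_index_newest k : pair_index k = (k.+1, other k) \/ pair_index k = (other k, k.+1).
Proof. by case: k => [|k]; [right|rewrite /=; case: ifP => _; [left|right]]. Qed.

Lemma pair_index_le k : ((pair_index k).1 <= k.+1)%N && ((pair_index k).2 <= k.+1)%N.
Proof.
elim: k => [//|k] /andP[_ le2] /=.
by case: ifP => _ /=; lia.
Qed.

Lemma pair_index_neq k : (pair_index k).1 != (pair_index k).2.
Proof.
case: k => [//|k] /=; have /andP[_ le2] := pair_index_le k.
by case: ifP => _ /=; lia.
Qed.

(** The first element of a pair is replaced by the difference and never returns; [pos] is injective
    for this reason. *)
Lemma pair_index_retired n k : (n < k)%N ->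
  ((pair_index n).1 != (pair_index k).1) && ((pair_index n).1 != (pair_index k).2).
Proof.
elim: k => [//|k IH]; rewrite ltnS leq_eqVlt => /predU1P[->|nk] /=.
  by have := pair_index_le k; have := pair_index_neq k; case: ifP => _ /=; lia.
by have := IH nk; have := pair_index_le n; case: ifP => _ /=; lia.
Qed.

End Slow.

(** Cramer's rule for a system of determinant 1 whose two right-hand sides are 1. The products g1 to
    g6 make it linear for [lia]. *)
Lemma det_sum (x y x' y' u e : nat) :
  (1 + y * e = x * u)%N -> (1 + x' * u = y' * e)%N -> (x * y' = x' * y + 1)%N ->
  (x + x' = e)%N /\ (y + y' = u)%N.
Proof.
move=> h1 h2 h3.
have g1 : (y' * (1 + y * e) = y' * (x * u))%N by rewrite h1.
have g2 : (y * (1 + x' * u) = y * (y' * e))%N by rewrite h2.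
have g3 : (x * y' * u = (x' * y + 1) * u)%N by rewrite h3.
have g4 : (x' * (1 + y * e) = x' * (x * u))%N by rewrite h1.
have g5 : (x * (1 + x' * u) = x * (y' * e))%N by rewrite h2.
have g6 : (x * y' * e = (x' * y + 1) * e)%N by rewrite h3.
by split; lia.
Qed.

(** * The generators in the order of creation *)

Section Creation.
Variables u d q : nat.
Notation V k := (slow_pair u d k).1.
Notation W k := (slow_pair u d k).2.
Notation pair_index := (pair_index u d).
Hypothesis u_gt0 : (0 < u)%N.
Hypothesis lt_u_d2 : (2 * u < d)%N.
Hypothesis co_ud : gcdn u d = 1%N.
Hypothesis q_gt1 : (1 < q)%N.
Hypothesis W_b : forall k, (k < q)%N -> (0 < gb (W k) <= gb (V k))%N.
Hypothesis Vq_b : gb (V q.-1) = 1%N.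
Hypothesis Wq_b : gb (W q.-1) = 1%N.

(* In the last step, where both elements have b = 1, their roles are exchanged:
   this gives F_(q+2) the sign required by its definition. *)
Definition created i := match i with
  | 0 => Gen (d - u) false 0 1
  | 1 => Gen u true 1 0
  | k.+2 => if k.+1 == q then gdiff (W k) (V k) else gdiff (V k) (W k) end.

Definition iV k := if k.+1 == q then (pair_index k).2 else (pair_index k).1.
Definition iW k := if k.+1 == q then (pair_index k).1 else (pair_index k).2.

Lemma created_ivw k : (k < q)%N -> created (pair_index k).1 = V k /\ created (pair_index k).2 = W k.
Proof.
elim: k => [//|k IH] kq; have [cV cW] := IH (ltnW kq).
rewrite slow_pairS /=; have kq' : (k.+1 == q) = false by lia.
by case: ifP => _ /=; rewrite cW kq'.
Qed.

Lemma created_iV k : (k < q)%N -> created (iV k) = if k.+1 == q then W k else V k.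
Proof. by move=> /created_ivw[cV cW]; rewrite /iV; case: ifP. Qed.

Lemma created_iW k : (k < q)%N -> created (iW k) = if k.+1 == q then V k else W k.
Proof. by move=> /created_ivw[cV cW]; rewrite /iW; case: ifP. Qed.

Lemma created_diff k : (k < q)%N -> created k.+2 = gdiff (created (iV k)) (created (iW k)).
Proof. by move=> kq; rewrite created_iV // created_iW //=; case: ifP. Qed.

Lemma created_type k : (k < q)%N -> gs (created (iW k)) = ~~ gs (created (iV k)).
Proof.
by move=> kq; rewrite created_iV // created_iW //; case: ifP => _; rewrite slow_pair_type ?negbK.
Qed.

Lemma created_b k : (k < q)%N -> (0 < gb (created (iW k)) <= gb (created (iV k)))%N.
Proof.
move=> kq; rewrite created_iV // created_iW //; case: eqP => [E|_]; last exact: W_b.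
have -> : k = q.-1 by lia.
by rewrite Vq_b Wq_b.
Qed.

Lemma gdeg_gt0 i : (0 < gdeg (created i))%N.
Proof.
have h k : (0 < gdeg (V k))%N && (0 < gdeg (W k))%N.
  elim: k => [//|k /andP[h1 h2]]; rewrite slow_pairS; case: ifP => _ /=; rewrite h2 ?andbT /=;
  by move: h1; rewrite /gdeg /=; lia.
case: i => [//|[//|k]] /=; have := h k; case: ifP => _; rewrite /gdeg /=; lia.
Qed.

Lemma created_tower (K : fieldType) : tower K q (gb \o created) (genA \o created) (genB \o created) iV iW
  (other u d) (gdeg \o created).
Proof.
split=> /=.
- by move=> i; apply: bideg_genA.
- by move=> i; apply: bideg_genB.
- exact: gdeg_gt0.
- by move=> k kq; rewrite /iV /iW; case: (pair_index_newest u d k) => ->; case: ifP => _ /=; auto.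
- by [].
- by move=> k kq; rewrite /iW; case: eqP => [|_ //]; lia.
- exact: created_b.
- by move=> k kq; rewrite -[if _ then _ else _]/(created k.+2) created_diff.
- by move=> k kq; rewrite -[if _ then _ else _]/(created k.+2) created_diff // genA_diff // created_type.
- by move=> k kq; rewrite -[if _ then _ else _]/(created k.+2) created_diff // genB_diff // created_type.
- move=> i i2; rewrite /binom /= !mpolyXn -!mpolyXD binom_neq0 //; apply/eqP => /mnmP/(_ iT0).
  by case: i i2 => [|[|//]] _; rewrite /genA /genB /= /mon02 /mon1 !(mnmDE, mulmnE, mnm1E) /=; lia.
- move=> g h; apply: (base_syzygy (u := u) (e := (d - u)%N)) => //.
    by rewrite /binom /= /genA /genB /= /mon02 /mon1 mulm0n add0m !mulm1n.
  by rewrite /binom /= /genA /genB /= /mon02 /mon1 mulm0n addm0 !mulm1n.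
Qed.

Lemma slow_pair_ok k : (k < q)%N -> gen_ok u d (V k) && gen_ok u d (W k).
Proof.
elim: k => [_|k IH kq]; first by rewrite /gen_ok /=; lia.
have /andP[hV hW] := IH (ltnW kq); have /andP[_ le] := W_b (ltnW kq).
have hD := gen_ok_diff le (slow_pair_type u d k) hV hW.
by rewrite slow_pairS; case: ifP => _; rewrite hW hD.
Qed.

Lemma created_ok i : (i < q.+2)%N -> gen_ok u d (created i).
Proof.
case: i => [_|[_|k kq]]; [by rewrite /gen_ok /=; lia | by rewrite /gen_ok /=; lia|].
have kq' : (k < q)%N by lia.
have /andP[hV hW] := slow_pair_ok kq'.
rewrite created_diff //; have /andP[_ le] := created_b kq'; have t := created_type kq'.
by apply: gen_ok_diff => //; rewrite ?created_iV ?created_iW //; case: ifP.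
Qed.

(** Two vectors with b = 1 and determinant 1 or -1 have a determined difference ([det_sum]): it is
    the conventional pair of index q+2, up to the sign that the exchanged roles fix. *)
Lemma created_last : [/\ gb (created q.+1) = 0%N, gx (created q.+1) = (d - u)%N, gy (created q.+1) = u
  & gs (created q.+1) = ~~ gs (V q.-1)].
Proof.
have q0 : q = q.-1.+1 by lia.
have -> : created q.+1 = gdiff (W q.-1) (V q.-1) by rewrite {1}q0 /= -q0 eqxx.
have kq : (q.-1 < q)%N by lia.
have := slow_pair_ok kq; have := det_slow_pair u d q.-1; have := slow_pair_type u d q.-1; move: Vq_b Wq_b.
case: (V q.-1) => b s x y; case: (W q.-1) => c t x' y' /= -> -> ->.
rewrite /gen_ok /det_ok /=.
case: s => /= D /andP[/andP[h1 /eqP e1] /andP[h2 /eqP e2]].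
  by have [E1 E2] := det_sum e1 e2 D; split; rewrite // addnC.
by have [E1 E2] := det_sum e2 e1 D.
Qed.

(** X-degrees add at each creation; one summand is the degree of the previous element and the other
    is positive. *)
Lemma gdeg_incr i j : (i < j)%N -> (1 < j < q.+2)%N -> (gdeg (created i) < gdeg (created j))%N.
Proof.
elim: j => [//|[//|j] IH] ij /andP[_ jq].
have jq' : (j < q)%N by lia.
have pV := gdeg_gt0 (iV j); have pW := gdeg_gt0 (iW j).
have D : gdeg (created j.+2) = (gdeg (created (iV j)) + gdeg (created (iW j)))%N.
  by rewrite created_diff // /gdeg /=; lia.
have new : (gdeg (created j.+1) < gdeg (created j.+2))%N.
  rewrite D /iV /iW; rewrite /iV /iW in pV pW.
  case: (pair_index_newest u d j) pV pW => -> /=; case: ifP => _ /=; lia.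
move: ij; rewrite ltnS leq_eqVlt => /predU1P[-> //|ij].
case: j IH ij jq {jq' pV pW D} new => [|j] IH ij jq new; last by apply: ltn_trans new; apply: IH; lia.
by case: i {IH} ij new => [|//] _; rewrite /gdeg /=.
Qed.

(** A new element has the type of V and a smaller b, and takes its place in the pair; so each type
    keeps its minimum in the current pair. *)
Lemma gb_min k i : (k < q)%N -> (i <= k.+1)%N ->
  (gs (created i) = gs (V k) -> gb (V k) <= gb (created i))%N /\
  (gs (created i) = gs (W k) -> gb (W k) <= gb (created i))%N.
Proof.
elim: k i => [|k IH] i kq; first by case: i => [|[|//]].
have [_ cW] := created_ivw (ltnW kq); have t := slow_pair_type u d k.
have := W_b (ltnW kq) => /andP[w0 le].
have eD : created k.+2 = gdiff (V k) (W k) by rewrite /= (_ : (k.+1 == q) = false) //; lia.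
rewrite leq_eqVlt ltnS slow_pairS => /predU1P[->|ik].
  by rewrite eD; case: ifP => _ /=; rewrite t; case: (gs _).
have [hV hW] := IH i (ltnW kq) ik.
by case: ifP => _ /=; split=> // /hV; lia.
Qed.

Lemma gb_decr i j : (i < j <= q)%N -> gs (created i) = gs (created j) -> (gb (created j) < gb (created i))%N.
Proof.
case: j => [|[|j]]; first by lia.
  by case: i.
move=> /andP[ij jq]; have jq' : (j < q)%N by lia.
have := W_b jq' => /andP[w0 le].
have -> : created j.+2 = gdiff (V j) (W j) by rewrite /= (_ : (j.+1 == q) = false) //; lia.
by move=> /= t; have [hV _] := gb_min jq' (i := i) ij; have := hV t; lia.
Qed.

Lemma gb_gt0 i : (i <= q)%N -> (0 < gb (created i))%N.
Proof.
case: i => [|[|i]] iq; [by rewrite /=; lia | by [] |].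
have iq' : (i.+1 < q)%N by lia.
have := W_b iq' => /andP[w0 le].
have -> : created i.+2 = gdiff (V i) (W i) by rewrite /= (_ : (i.+1 == q) = false) //; lia.
by move: w0 le; rewrite slow_pairS; case: ifP => _ /=; lia.
Qed.

(* A vector of the cone of type s decomposes as n E - m O along the pair {E, O}
   of step k (in absolute values, n E + m O), until an element of type s fits. *)
Lemma cone_divides s b x y : (0 < b)%N -> gen_ok u d (Gen b s x y) ->
  exists2 i, (i <= q)%N &
    [/\ gs (created i) = s, (gb (created i) <= b)%N, (gx (created i) <= x)%N & (gy (created i) <= y)%N].
Proof.
move=> b0 ok.
pose E k := if gs (V k) == s then V k else W k.
pose O k := if gs (V k) == s then W k else V k.
pose found := exists2 i, (i <= q)%N &
  [/\ gs (created i) = s, gb (created i) <= b, gx (created i) <= x & gy (created i) <= y]%N.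
have E_created k : (k < q)%N -> exists2 i, (i <= q)%N & created i = E k.
  move=> kq; have [cV cW] := created_ivw kq; have /andP[le1 le2] := pair_index_le u d k.
  by rewrite /E; case: ifP => _; [exists (pair_index k).1|exists (pair_index k).2] => //; lia.
have E_type k : gs (E k) = s.
  by rewrite /E; case: eqP => // /eqP; rewrite slow_pair_type; case: (gs _); case: (s).
suff loop k : (k < q)%N -> found \/ exists n m, [/\ (0 < n)%N,
    x = (n * gx (E k) + m * gx (O k))%N, y = (n * gy (E k) + m * gy (O k))%N
    & (b + m * gb (O k) = n * gb (E k))%N].
  have kq : (q.-1 < q)%N by lia.
  have [//|[n [m [n0 xE yE]]]] := loop _ kq.
  have -> : gb (E q.-1) = 1%N by rewrite /E; case: ifP.
  have -> : gb (O q.-1) = 1%N by rewrite /O; case: ifP.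
  move=> bE; have [i iq ci] := E_created _ kq; exists i => //; rewrite ci E_type; split=> //.
  - by rewrite /E; case: ifP => _; rewrite ?Vq_b ?Wq_b.
  - by rewrite xE (leq_trans _ (leq_addr _ _)) // leq_pmull.
  - by rewrite yE (leq_trans _ (leq_addr _ _)) // leq_pmull.
elim: k => [|k IH] kq.
  right; move: ok; rewrite /gen_ok /E /O /=; case: (s) => /= /andP[p /eqP e].
    by exists x, y; split=> //; lia.
  by exists y, x; split=> //; lia.
have [|[n [m [n0 xE yE bE]]]] := IH (ltnW kq); first by left.
have [i iq ci] := E_created _ (ltnW kq).
have [m0|m0] := posnP m.
  left; exists i => //; rewrite ci E_type.
  move: xE yE bE; rewrite m0 !mul0n !addn0 => -> -> ->.
  by split=> //; rewrite leq_pmull.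
have t := slow_pair_type u d k; have /andP[w0 le] := W_b (ltnW kq).
have cD : created k.+2 = gdiff (V k) (W k) by rewrite /= (_ : (k.+1 == q) = false) //; lia.
(* Here E = V, and the new element is E + O in absolute values. If m <= n it fits, as b = (n-m) b_V
   + m (b_V - b_W); otherwise n E + m O = n (E + O) + (m-n) O continues the loop. *)
have [tV|tV] := boolP (gs (V k) == s).
  have eE : E k = V k by rewrite /E tV.
  have eO : O k = W k by rewrite /O tV.
  rewrite eE eO in xE yE bE.
  have [mn|nm] := leqP m n.
    left; exists k.+2; first lia.
    rewrite cD /= (eqP tV).
    have [l nE] : exists l, n = (m + l)%N by exists (n - m)%N; lia.
    have [m' mE] : exists m', m = m'.+1 by exists m.-1; lia.
    have [c bV] : exists c, gb (V k) = (gb (W k) + c)%N by exists (gb (V k) - gb (W k))%N; lia.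
    subst n m; rewrite bV in bE *; rewrite !mulnDl !mulnDr !mulSn in xE yE bE.
    by split=> //; lia.
  right; exists n, (m - n)%N.
  have [l mE] : exists l, m = (n + l)%N by exists (m - n)%N; lia.
  have [c bV] : exists c, gb (V k) = (gb (W k) + c)%N by exists (gb (V k) - gb (W k))%N; lia.
  have [-> ->] : E k.+1 = gdiff (V k) (W k) /\ O k.+1 = W k.
    by rewrite /E /O slow_pairS; case: (_ <= _)%N; rewrite /= ?t ?tV //; move: tV; case: (gs _); case: (s).
  rewrite /= bV addKn mE addKn; rewrite mE bV in xE yE bE.
  by split=> //; move: xE yE bE; rewrite !mulnDl !mulnDr; lia.
have eE : E k = W k by rewrite /E (negbTE tV).
have eO : O k = V k by rewrite /O (negbTE tV).
rewrite eE eO in xE yE bE.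
have [c bV] : exists c, gb (V k) = (gb (W k) + c)%N by exists (gb (V k) - gb (W k))%N; lia.
(* Here E = W. As b > 0 and b_W <= b_V, the b-equation forces m < n, and n E + m O = (n-m) E + m (E
   + O). *)
have mn : (m < n)%N.
  rewrite -(ltn_pmul2r w0); move: bE; rewrite bV mulnDr; lia.
right; exists (n - m)%N, m.
have [l nE] : exists l, n = (m + l)%N by exists (n - m)%N; lia.
have [-> ->] : E k.+1 = W k /\ O k.+1 = gdiff (V k) (W k).
  by rewrite /E /O slow_pairS; case: (_ <= _)%N; rewrite /= ?t ?(negbTE tV) //; move: tV; case: (gs _); case: (s).
rewrite /= bV addKn nE addKn; rewrite nE bV in xE yE bE mn.
by split; move: xE yE bE; rewrite ?mulnDl ?mulnDr; lia.
Qed.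

(** * Monomials with the same image and generation of the kernel *)

Definition lmon i : 'X_{1..5} := (U_(iT0) *+ gb (created i) + genA (created i))%MM.
Definition rmon i : 'X_{1..5} := (U_(iT1) *+ gb (created i) + genB (created i))%MM.

Lemma genE g :
  (genA g iT0 = 0 /\ genA g iT1 = 0 /\ genB g iT0 = 0 /\ genB g iT1 = 0)%N /\
  (if gs g then
     (genA g iX0 = 0 /\ genA g iX1 = gdeg g /\ genA g iX2 = 0) /\
     (genB g iX0 = gx g /\ genB g iX1 = 0 /\ genB g iX2 = gy g)
   else
     (genA g iX0 = gx g /\ genA g iX1 = 0 /\ genA g iX2 = gy g) /\
     (genB g iX0 = 0 /\ genB g iX1 = gdeg g /\ genB g iX2 = 0))%N.
Proof.
by rewrite /genA /genB /mon1 /mon02; case: (gs g);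
  rewrite !(mnmDE, mulmnE, mnm1E) /= !mul0n ?mul1n ?addn0.
Qed.

Lemma fibreP m m' : fibre u d m = fibre u d m' <->
  [/\ Zdeg m = Zdeg m', Tmon u d m rT0 = Tmon u d m' rT0 & Tmon u d m rT1 = Tmon u d m' rT1].
Proof.
split=> [E|[hZ h0 h1]]; last by congr (_, _); [exact: hZ|exact: mnm2P].
by have /= -> := congr1 fst E; have /= -> := congr1 snd E.
Qed.

Lemma fibreD w m m' : fibre u d m = fibre u d m' -> fibre u d (w + m) = fibre u d (w + m').
Proof.
move=> /fibreP[hZ]; rewrite !Tmon0 !Tmon1 => h0 h1; apply/fibreP; move: hZ.
by rewrite !Tmon0 !Tmon1 /Zdeg !mnmDE !mulnDr; split; lia.
Qed.

Lemma d_split : exists e, [/\ d = (u + e)%N, (d - u = e)%N & (0 < e)%N].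
Proof. by exists (d - u)%N; split; lia. Qed.

Lemma fibre_lrmon i : (i < q.+2)%N -> fibre u d (lmon i) = fibre u d (rmon i).
Proof.
move=> /created_ok; have [e [dE eE _]] := d_split; rewrite /gen_ok eE => ok.
apply/fibreP; rewrite !Tmon0 !Tmon1 /Zdeg /lmon /rmon eE.
rewrite !(mnmDE, mulmnE, mnm1E) /= !mul0n !mul1n !add0n.
have [[-> [-> [-> ->]]]] := genE (created i); move: ok.
case: (gs _) => /andP[_ /eqP ok] [[-> [-> ->]] [-> [-> ->]]]; rewrite /gdeg dE;
by rewrite !mulnDl !mulnDr; split; lia.
Qed.

Lemma lead_divides m m' : fibre u d m = fibre u d m' -> (m' iT0 < m iT0)%N ->
  exists2 i, (i <= q)%N & (lmon i <= m)%MM.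
Proof.
have lmonP i : (gb (created i) <= m iT0)%N ->
    (if gs (created i) then gdeg (created i) <= m iX1 else (gx (created i) <= m iX0) && (gy (created i) <= m iX2))%N ->
    (lmon i <= m)%MM.
  move=> hb hg; have [[h1 [h2 [_ _]]] h3] := genE (created i).
  apply: mnm5_le; rewrite /lmon mnmDE mulmnE mnm1E /= ?mul1n ?mul0n ?h1 ?h2; try lia;
  by move: h3 hg; case: (gs _) => -[[E0 [E1 E2]] _]; lia.
have [e [dE eE e0]] := d_split.
move=> /fibreP[]; rewrite !Tmon0 !Tmon1 /Zdeg eE => hZ h0 h1 lt0.
have [b bE] : exists b, m iT0 = (m' iT0 + b)%N by exists (m iT0 - m' iT0)%N; lia.
(* Signs of the changes from m' to m. If X2 grows and X0 does not, by y and -x, then T0 gains u x +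
   (d-u) y and generator 0 divides. If both grow, the cone of sigma <= 0 applies. If X2 does not
   grow, X0 must drop, and the cone of sigma > 0 applies. *)
have [lt4|le4] := ltnP (m' iX2) (m iX2).
  have [y yE] : exists y, m iX2 = (m' iX2 + y)%N by exists (m iX2 - m' iX2)%N; lia.
  have [le2|lt2] := leqP (m iX0) (m' iX0).
    exists 0%N => //; apply: lmonP => /=; last by lia.
    have [x xE] : exists x, m' iX0 = (m iX0 + x)%N by exists (m' iX0 - m iX0)%N; lia.
    have E : (m iX1 + y = m' iX1 + x)%N by lia.
    have := congr1 (muln e) E; rewrite eE; move: h0; rewrite xE dE !mulnDr !mulnDl => h0 E'.
    have : (e <= e * y)%N by rewrite leq_pmulr; lia.
    by lia.
  have [x xE] : exists x, m iX0 = (m' iX0 + x)%N by exists (m iX0 - m' iX0)%N; lia.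
  have E : (m' iX1 = m iX1 + x + y)%N by lia.
  have [||i iq [ti b_i x_i y_i]] := @cone_divides false b x y; first by lia.
    rewrite /gen_ok eE /=; apply/andP; split; first by lia.
    by move: h0; rewrite bE xE E dE !mulnDr !mulnDl; lia.
  by exists i => //; apply: lmonP; rewrite ?ti; lia.
have [y yE] : exists y, m' iX2 = (m iX2 + y)%N by exists (m' iX2 - m iX2)%N; lia.
have [lt2|le2] := ltnP (m iX0) (m' iX0); last first.
  have [x xE] : exists x, m iX0 = (m' iX0 + x)%N by exists (m iX0 - m' iX0)%N; lia.
  have E : (m iX1 + x = m' iX1 + y)%N by lia.
  have := congr1 (muln e) E; move: h0; rewrite bE xE dE !mulnDr !mulnDl; lia.
have [x xE] : exists x, m' iX0 = (m iX0 + x)%N by exists (m' iX0 - m iX0)%N; lia.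
have E : (m iX1 = m' iX1 + x + y)%N by lia.
have [||i iq [ti b_i x_i y_i]] := @cone_divides true b x y; first by lia.
  rewrite /gen_ok eE /=; apply/andP; split; first by lia.
  by move: h0; rewrite bE xE E dE !mulnDr !mulnDl; lia.
by exists i => //; apply: lmonP; rewrite ?ti /gdeg; lia.
Qed.

Lemma genAB_last : exists Y Z,
  [/\ Y = mon02 (d - u) u, Z = mon1 d,
      lmon q.+1 = (if gs (V q.-1) then Y else Z) & rmon q.+1 = (if gs (V q.-1) then Z else Y)].
Proof.
have [b0 xd yu ts] := created_last; exists (mon02 (d - u) u), (mon1 d); split=> //.
  rewrite /lmon b0 mulm0n add0m /genA ts /gdeg xd yu (_ : (d - u + u)%N = d); last lia.
  by case: (gs (V _)).
rewrite /rmon b0 mulm0n add0m /genB ts /gdeg xd yu (_ : (d - u + u)%N = d); last lia.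
by case: (gs (V _)).
Qed.

(** With T0 fixed, the changes x of X0 and t of X2 satisfy u x = (d-u) t; by coprimality they are
    multiples of d-u and u, and the last generator accounts for the whole difference. *)
Lemma fibre_flat m m' : fibre u d m = fibre u d m' -> m iT0 = m' iT0 ->
  m iT1 = m' iT1 /\ exists w k,
    m = (w + lmon q.+1 *+ k)%MM /\ m' = (w + rmon q.+1 *+ k)%MM \/
    m' = (w + lmon q.+1 *+ k)%MM /\ m = (w + rmon q.+1 *+ k)%MM.
Proof.
have [e [dE eE e0]] := d_split.
have [Y [Z [YE ZE -> ->]]] := genAB_last.
suff main m1 m2 : fibre u d m1 = fibre u d m2 -> m1 iT0 = m2 iT0 -> (m2 iX0 <= m1 iX0)%N ->
    m1 iT1 = m2 iT1 /\ exists w k, m1 = (w + Y *+ k)%MM /\ m2 = (w + Z *+ k)%MM.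
  move=> fE E0; have [le|/ltnW le] := leqP (m' iX0) (m iX0).
    have [-> [w [k [-> ->]]]] := main _ _ fE E0 le; split=> //; exists w, k.
    by case: (gs _); auto.
  have [-> [w [k [-> ->]]]] := main _ _ (esym fE) (esym E0) le; split=> //; exists w, k.
  by case: (gs _); auto.
move=> /fibreP[]; rewrite !Tmon0 !Tmon1 /Zdeg eE => hZ h0 h1 E0 le0.
have [x xE] : exists x, m1 iX0 = (m2 iX0 + x)%N by exists (m1 iX0 - m2 iX0)%N; lia.
have le3 : (m1 iX1 <= m2 iX1)%N.
  by rewrite -(leq_pmul2l e0); move: h0; rewrite E0 xE mulnDr; lia.
have [s sE] : exists s, m2 iX1 = (m1 iX1 + s)%N by exists (m2 iX1 - m1 iX1)%N; lia.
have sx : (d * x = e * s)%N by move: h0; rewrite E0 xE sE !mulnDr; lia.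
have [t tE] : exists t, (s = x + t)%N.
  exists (s - x)%N; rewrite subnKC // -(leq_pmul2l e0) -sx dE mulnDl; lia.
have yE : m1 iX2 = (m2 iX2 + t)%N by lia.
have ut : (u * x = e * t)%N by move: sx; rewrite tE dE mulnDl mulnDr; lia.
have E1 : m1 iT1 = m2 iT1.
  by move: h1; rewrite yE sE tE dE !mulnDr !mulnDl; lia.
split=> //.
have /dvdnP[k kE] : (e %| x)%N.
  rewrite -(@Gauss_dvdr e u) ?ut ?dvdn_mulr // /coprime.
  by rewrite -eE gcdnC -gcdnDr subnK ?co_ud //; lia.
have tk : t = (u * k)%N.
  by apply/eqP; rewrite -(eqn_pmul2l e0) -ut kE; apply/eqP; lia.
exists (m1 - Y *+ k)%MM, k; rewrite YE ZE eE /mon02 /mon1; split;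
  apply: mnm5P; rewrite !(mnmDE, mnmBE, mulmnE, mnm1E) /= ?mul0n ?mul1n ?mul0n;
  rewrite ?xE ?yE ?kE ?tk ?sE ?tE ?dE ?mulnDl; lia.
Qed.

Lemma lmon_in i (m : 'X_{1..5}) : (lmon i <= m)%MM ->
  [/\ gb (created i) <= m iT0, genA (created i) iX0 <= m iX0, genA (created i) iX1 <= m iX1,
      genA (created i) iX2 <= m iX2 & gdeg (created i) <= Zdeg m]%N.
Proof.
move=> /mnm_lepP le; have := le iT0; have := le iX0; have := le iX1; have := le iX2.
have [[h1 [h2 _]] h3] := genE (created i).
rewrite /lmon !(mnmDE, mulmnE, mnm1E) /= !mul0n !mul1n h1 addn0 !add0n => l4 l3 l2 l0.
split=> //; rewrite /Zdeg; move: h3; case: (gs _) => -[[E0 [E1 E2]] _]; move: l4 l3 l2;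
by rewrite E0 E1 E2 /gdeg; lia.
Qed.

Section Ideal.
Variable K : fieldType.
Local Notation S := {mpoly K[5]}.
Notation C := (binom K (gb \o created) (genA \o created) (genB \o created)).

Lemma binomE i : C i = 'X_[lmon i] - 'X_[rmon i].
Proof. by rewrite /binom /= !mpolyXn -!mpolyXD. Qed.

Lemma ker_binom i : (i < q.+2)%N -> kerPhi0 u d (C i).
Proof.
move=> iq; rewrite /kerPhi0 binomE /Phi0 mmapB -/(Phi0 u d _) -/(Phi0 u d _) !Phi0X.
have := fibre_lrmon iq; move=> E; have /= -> := congr1 fst E; have /= -> := congr1 snd E.
by rewrite subrr.
Qed.

Definition creation_ideal : S -> Prop := ideal_gen (fun y => exists2 i, (i < q.+2)%N & y = C i).

(** Dividing the monomial with larger T0-exponent by a leading monomial trades a positive power of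
    T0 for T1, so the sum of the T0-exponents decreases; once these agree, the last generator
    suffices. *)
Lemma binom_in_ideal m m' : fibre u d m = fibre u d m' -> creation_ideal ('X_[m] - 'X_[m']).
Proof.
have [n le_n] := ubnP (m iT0 + m' iT0)%N.
elim: n m m' le_n => [//|n IH] m m' le_n.
wlog le0 : m m' le_n / (m' iT0 <= m iT0)%N => [W fE|fE].
  have [le|/ltnW le] := leqP (m' iT0) (m iT0); first exact: W.
  by rewrite -opprB; apply/ideal_genN/W => //; rewrite addnC.
move: le0; rewrite leq_eqVlt => /predU1P[E|lt0].
  have [_ [w [k]]] := fibre_flat fE (esym E).
  have in_last : creation_ideal ('X_[lmon q.+1] - 'X_[rmon q.+1]).
    by apply: ideal_gen_mem; exists q.+1; rewrite ?binomE.
  move=> [[-> ->]|[-> ->]]; first exact: ideal_binom_pow.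
  by rewrite -opprB; apply/ideal_genN/ideal_binom_pow.
have [i iq le_i] := lead_divides fE lt0.
have iq2 : (i < q.+2)%N by lia.
pose w := (m - lmon i)%MM; have mE : m = (w + lmon i)%MM by rewrite submK.
have fw : fibre u d m = fibre u d (w + rmon i) by rewrite {1}mE; apply/fibreD/fibre_lrmon.
have -> : 'X_[m] - 'X_[m'] = 'X_[w] * C i + ('X_[w + rmon i] - 'X_[m']) :> S.
  by rewrite binomE {1}mE !mpolyXD; ring.
apply: ideal_genD; first by apply/ideal_genM/ideal_gen_mem; exists i.
apply: IH; last by rewrite -fw.
have b0 := gb_gt0 iq; have [lb _ _ _ _] := lmon_in le_i.
have [[_ [_ [r0 _]]] _] := genE (created i); have [[l0 _] _] := genE (created i).
rewrite /rmon /w /lmon !(mnmDE, mnmBE, mulmnE, mnm1E) /= r0 l0 !mul0n; lia.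
Qed.

Lemma ker_creation (x : S) : kerPhi0 u d x <-> creation_ideal x.
Proof.
split=> [/kerPhi0P fib0|]; first exact: (fibre_span fib0 binom_in_ideal).
move=> [n [c [g [gC ->]]]]; rewrite /kerPhi0 /Phi0 raddf_sum big1 //= => i _.
rewrite rmorphM /=; have [j jq ->] := gC i.
by have := ker_binom jq; rewrite /kerPhi0 /Phi0 => ->; rewrite mulr0.
Qed.

End Ideal.

(** Creation number of the generator at place i: the first element of the pair of step i. The last
    place takes the second element of step q, whose creation number is q+1. *)
Definition pos (i : nat) := if i == q.+1 then (pair_index q).2 else (pair_index i).1.

Lemma pos_lt i : (i < q.+2)%N -> (pos i < q.+2)%N.
Proof.
rewrite /pos; case: eqP => ne iq; last by have /andP[h _] := pair_index_le u d i; lia.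
by have /andP[_ h] := pair_index_le u d q; lia.
Qed.

Lemma pos_inj i j : (i < q.+2)%N -> (j < q.+2)%N -> pos i = pos j -> i = j.
Proof.
wlog ij : i j / (i <= j)%N => [W iq jq E|].
  have [ij|/ltnW ij] := leqP i j; first exact: W.
  by apply/esym/W.
move: ij; rewrite leq_eqVlt => /predU1P[//|ij] iq jq; rewrite /pos.
rewrite (_ : (i == q.+1) = false); last lia.
case: eqP => jE E.
  have [iq'|iq'] := ltnP i q.
    by have := pair_index_retired u d iq'; rewrite E eqxx andbF.
  have iE : i = q by lia.
  by have := pair_index_neq u d q; rewrite -E iE eqxx.
by have := pair_index_retired u d ij; rewrite E eqxx.
Qed.

Let qE : q = q.-1.+1. Proof. by lia. Qed.

Lemma pair_index_q : pair_index q = ((pair_index q.-1).2, q.+1).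
Proof. by rewrite {1}qE /= Vq_b Wq_b /= -qE. Qed.

Lemma V_q : V q = W q.-1.
Proof. by rewrite {1}qE slow_pairS /= Vq_b Wq_b. Qed.

Lemma created_pos i : (i <= q)%N -> created (pos i) = V i.
Proof.
move=> iq; rewrite /pos (_ : (i == q.+1) = false); last lia.
move: iq; rewrite leq_eqVlt => /predU1P[->|iq]; last by have [-> _] := created_ivw iq.
have q1 : (q.-1 < q)%N by lia.
by have [_ cW] := created_ivw q1; rewrite V_q pair_index_q.
Qed.

Lemma pos_last : pos q.+1 = q.+1.
Proof. by rewrite /pos eqxx pair_index_q. Qed.

Lemma sigma_q : (0 < sigman u d q q) = gs (V q.-1).
Proof.
rewrite /sigman (_ : (q == q.+2) = false); last lia.
rewrite {1}qE slow_pair_sers /= /gen_sigma.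
have : (q.-1 < q)%N by lia.
by move=> /slow_pair_ok /andP[+ _]; rewrite /gen_ok; case: (gs _) => /andP[p _]; lia.
Qed.

Lemma F0_binom (K : fieldType) (i : 'I_q.+2) :
  F0 u d K i = binom K (gb \o created) (genA \o created) (genB \o created) (pos i).
Proof.
rewrite /F0 /Fgen eqSS; case: eqP => [iE|iE].
  rewrite iE pos_last sigma_q binomE; have [Y [Z [-> -> -> ->]]] := genAB_last.
  rewrite !mpolyXn -mpolyXD /mon02 /mon1; by case: (gs _).
have iq : (i <= q)%N by have := ltn_ord i; lia.
rewrite /bn /sigman /taun eqSS (_ : (val i == q.+1) = false); last exact/eqP.
rewrite /binom /= created_pos // slow_pair_sers /= /gen_sigma /gen_tau /genA /genB /gdeg /mon02 /mon1.
have : gen_ok u d (V i) by rewrite -created_pos //; apply/created_ok/pos_lt.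
rewrite /gen_ok; case: (gs _) => /andP[x0 _].
  rewrite (_ : ((gx (V i))%:Z <= 0) = false); last by lia.
  rewrite (_ : `|(gx (V i))%:Z - - (gy (V i))%:Z|%N = (gx (V i) + gy (V i))%N); last by lia.
  by rewrite opprK !absz_nat !mpolyXD -!mpolyXn !mulrA.
rewrite (_ : (- (gx (V i))%:Z <= 0) = true); last by lia.
rewrite (_ : `|(gy (V i))%:Z - - (gx (V i))%:Z|%N = (gx (V i) + gy (V i))%N); last by lia.
by rewrite opprK !absz_nat !mpolyXD -!mpolyXn !mulrA.
Qed.

Lemma deg1_pos (i : 'I_q.+2) :
  deg1 u d i = ((gb (created (pos i)))%:Z, (gdeg (created (pos i)))%:Z).
Proof.
rewrite /deg1 /bn /sigman /taun eqSS; case: eqP => [iE|iE].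
  have [b0 xd yu _] := created_last; rewrite iE pos_last b0 /gdeg xd yu; congr (_, _); lia.
rewrite created_pos; last by have := ltn_ord i; lia.
rewrite slow_pair_sers /= /gen_sigma /gen_tau /gdeg; case: (gs _); congr (_, _); lia.
Qed.

(** * Comparison with the lexicographic order *)

(** The largest X_j for [prec_l]; it decides when the T-exponents tie, as they do for the last
    generator. *)
Definition iXl := if gs (V q.-1) then iX0 else iX1.

Lemma prec_lP (m' m : 'X_{1..5}) : prec_l u d q m' m ->
  (m' iT0 < m iT0)%N \/ m' iT0 = m iT0 /\ ((m' iT1 < m iT1)%N \/
  m' iT1 = m iT1 /\ (m' iXl <= m iXl)%N).
Proof.
rewrite /prec_l sigma_q /iXl; case: (gs _); rewrite /lex_lt /= !ltxi_cons !leEnat;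
by move=> /andP[l0 /implyP h0]; have [|e0] := ltnP (m' iT0) (m iT0); auto;
  have {h0} /andP[l1 /implyP h1] := h0 e0; have [|e1] := ltnP (m' iT1) (m iT1);
  right; (split; first by lia); auto; right; (split; first by lia);
  have /andP[] := h1 e1.
Qed.

Lemma prec_lT0 (m' m : 'X_{1..5}) : (m' iT0 < m iT0)%N -> prec_l u d q m' m.
Proof.
move=> lt0; rewrite /prec_l; case: ifP => _; rewrite /lex_lt /= ltxi_cons !leEnat;
by rewrite (ltnW lt0) (_ : (m iT0 <= m' iT0)%N = false) //; lia.
Qed.

Lemma prec_lXl (m' m : 'X_{1..5}) : m' iT0 = m iT0 -> m' iT1 = m iT1 ->
  (m' iXl < m iXl)%N -> prec_l u d q m' m.
Proof.
move=> e0 e1; rewrite /prec_l sigma_q /iXl; case: (gs _) => ltX.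
  rewrite /lex_lt /= !ltxi_cons !leEnat e0 e1 !leqnn (ltnW ltX) /=.
  by rewrite (_ : (m iX0 <= m' iX0)%N = false) //; lia.
rewrite /lex_lt /= !ltxi_cons !leEnat e0 e1 !leqnn (ltnW ltX) /=.
by rewrite (_ : (m iX1 <= m' iX1)%N = false) //; lia.
Qed.

Lemma lrmon_gap i : (i < q.+2)%N ->
  (rmon i iT0 < lmon i iT0)%N \/
  [/\ rmon i iT0 = lmon i iT0, rmon i iT1 = lmon i iT1 & (rmon i iXl < lmon i iXl)%N].
Proof.
rewrite ltnS leq_eqVlt => /predU1P[->|iq].
  right; have [Y [Z [-> -> -> ->]]] := genAB_last; rewrite /iXl /mon02 /mon1.
  by case: (gs _); rewrite !(mnmDE, mulmnE, mnm1E) /=; split; lia.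
left; have [[l0 [_ [r0 _]]] _] := genE (created i).
by rewrite /rmon /lmon !(mnmDE, mulmnE, mnm1E) /= l0 r0; have := gb_gt0 iq; lia.
Qed.

Lemma prec_lr i : (i < q.+2)%N ->
  prec_l u d q (rmon i) (lmon i) /\ ~~ prec_l u d q (lmon i) (rmon i).
Proof.
move=> iq; have gap := lrmon_gap iq; split.
  by case: gap => [/prec_lT0//|[e0 e1 /prec_lXl]]; apply.
by apply/negP => /prec_lP; case: gap => [|[]]; lia.
Qed.

(** Either T0 drops and [lead_divides] applies, or [fibre_flat] gives a multiple of the last
    binomial; its wrong orientation would raise the exponent of [iXl] and contradict the order. *)
Lemma lmon_divides_lead m m' : fibre u d m' = fibre u d m -> m' != m -> prec_l u d q m' m ->
  exists2 i, (i < q.+2)%N & (lmon i <= m)%MM.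
Proof.
move=> fE ne /prec_lP prec.
have [lt0|e0] : (m' iT0 < m iT0)%N \/ m' iT0 = m iT0 by lia.
  by have [i iq le_i] := lead_divides (esym fE) lt0; exists i => //; lia.
have [e1 [w [k [[mE mE']|[mE mE']]]]] := fibre_flat fE e0; last first.
  exists q.+1; rewrite // mE; case: k mE mE' => [|k] mE mE'.
    by rewrite mE mE' !mulm0n eqxx in ne.
  by rewrite mulmS addmC -addmA lem_addr.
have [lt|[_ _]] := lrmon_gap (ltnSn q.+1).
  have [b0 _ _ _] := created_last; have [[l0 _] _] := genE (created q.+1).
  by move: lt; rewrite /lmon mnmDE mulmnE b0 l0 muln0; lia.
case: k mE mE' => [|k] mE mE'; first by rewrite mE mE' !mulm0n eqxx in ne.
have : (m' iXl <= m iXl)%N by lia.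
by rewrite mE mE' !(mnmDE, mulmnE) leq_add2l leq_pmul2r // => le lt; lia.
Qed.

(** X-degrees increase with the creation number, while b decreases inside a type: a later element is
    too large in the X_j, an earlier one of the same type too large in T0, and opposite types use
    disjoint X-variables. A right monomial has no T0 at all. *)
Lemma no_division i j m : (i < q.+2)%N -> (j < q.+2)%N -> i <> j ->
  m = lmon i \/ m = rmon i -> ~ (lmon j <= m)%MM.
Proof.
move=> iq jq ne mE /lmon_in[le0 le2 le3 le4 leZ].
have [[a0 [a1 [b0 b1]]] hi] := genE (created i).
have [_ hj] := genE (created j).
have gi : (genA (created i) iX0 + genA (created i) iX1 + genA (created i) iX2 = gdeg (created i))%N.
  by move: hi; case: (gs _) => -[[-> [-> ->]] _]; rewrite /gdeg; lia.
have gi' : (genB (created i) iX0 + genB (created i) iX1 + genB (created i) iX2 = gdeg (created i))%N.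
  by move: hi; case: (gs _) => -[_ [-> [-> ->]]]; rewrite /gdeg; lia.
have Zi : Zdeg m = gdeg (created i).
  by rewrite /Zdeg; case: mE => ->; rewrite /lmon /rmon !(mnmDE, mulmnE, mnm1E) /= !mul0n !add0n.
rewrite {}Zi in leZ.
move: jq; rewrite ltnS leq_eqVlt => /predU1P[jE|jq].
  have := @gdeg_incr i j; rewrite jE in ne leZ *; lia.
have bj := gb_gt0 jq.
case: mE le0 le2 le3 le4 => ->; rewrite /lmon /rmon !(mnmDE, mulmnE, mnm1E) /= ?a0 ?b0; last by lia.
rewrite !mul0n mul1n !add0n addn0 => le0 le2 le3 le4.
have {}iq : (i <= q)%N.
  move: iq; rewrite ltnS leq_eqVlt => /predU1P[iE|//].
  by have [bq _ _ _] := created_last; move: le0; rewrite iE bq; lia.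
have jq2 : (j < q.+2)%N by lia.
have [t|t] := eqVneq (gs (created i)) (gs (created j)); last first.
  have := created_ok jq2; rewrite /gen_ok; move: hi hj t le2 le3 le4; rewrite /gdeg.
  by case: (gs (created i)); case: (gs (created j)) => // -[[-> [-> ->]] _] [[-> [-> ->]] _] _; lia.
have [ij|ji|//] := ltngtP i j.
  have [j1|j1] := leqP j 1; last by have := @gdeg_incr i j; lia.
  have [iE jE] : i = 0%N /\ j = 1%N by clear -ij j1; lia.
  by rewrite iE jE in t.
by have := @gb_decr j i; rewrite ji iq t => /(_ isT erefl); lia.
Qed.

Lemma pos_onto j : (j < q.+2)%N -> exists i : 'I_q.+2, pos i = j.
Proof.
move=> jq; pose p (i : 'I_q.+2) := Ordinal (pos_lt (ltn_ord i)).
have [p' _ p'K] : bijective p.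
  by apply: injF_bij => i i' /(congr1 val) /= /pos_inj E; apply/val_inj/E.
by exists (p' (Ordinal jq)); have /(congr1 val) := p'K (Ordinal jq).
Qed.

(** * The reduced Gröbner basis *)

Section GroebnerBasis.
Variable K : fieldType.
Local Notation S := {mpoly K[5]}.
Local Notation F := (@F0 u d q K).
Local Notation prec := (prec_l u d q).

Lemma F0E (i : 'I_q.+2) : F i = 'X_[lmon (pos i)] - 'X_[rmon (pos i)].
Proof. by rewrite F0_binom binomE. Qed.

Lemma ker_F0 (x : S) : kerPhi0 u d x <-> ideal_gen (subfam F setT) x.
Proof.
rewrite ker_creation; split; apply: ideal_gen_trans => y.
  move=> [j /pos_onto[i <-] ->]; apply: ideal_gen_mem; exists i; first by rewrite inE.
  by rewrite F0_binom.
move=> [i _ ->]; apply: ideal_gen_mem; exists (pos i); first exact/pos_lt/ltn_ord.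
by rewrite F0_binom.
Qed.

Lemma msupp_F0 (i : 'I_q.+2) m : m \in msupp (F i) -> m = lmon (pos i) \/ m = rmon (pos i).
Proof.
rewrite F0E => /msuppB_le; rewrite mem_cat !msuppX !inE.
by case/orP => /eqP ->; [left|right].
Qed.

Lemma lmon_neq_rmon i : (i < q.+2)%N -> rmon i != lmon i.
Proof.
by move=> iq; apply/eqP => E; have := lrmon_gap iq; rewrite E => -[|[]]; lia.
Qed.

Lemma F0_lmon (i : 'I_q.+2) : (F i)@_(lmon (pos i)) = 1.
Proof.
have iq := pos_lt (ltn_ord i).
by rewrite F0E mcoeffB !mcoeffX eqxx (negbTE (lmon_neq_rmon iq)) subr0.
Qed.

Lemma is_lead_F0 (i : 'I_q.+2) m : is_lead prec (F i) m <-> m = lmon (pos i).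
Proof.
have [lr nlr] := prec_lr (pos_lt (ltn_ord i)).
have lF : lmon (pos i) \in msupp (F i) by rewrite mcoeff_msupp F0_lmon oner_eq0.
split=> [[mF lead_m]|->].
  have [//|mE] := msupp_F0 mF.
  apply/eqP/negPn/negP => ne; move/negP: nlr; apply; rewrite -mE.
  by apply: lead_m => //; rewrite eq_sym.
by split=> // m' /msupp_F0[->|->] //; rewrite eqxx.
Qed.

Lemma monomial_ideal_lmon (J : {set 'I_q.+2}) (m : 'X_{1..5}) :
  ideal_gen (lead_terms prec (subfam F J)) ('X_[m] : S) ->
  exists2 i, i \in J & (lmon (pos i) <= m)%MM.
Proof.
move=> [n [c [g [gF E]]]].
have [j mj] : exists j, m \in msupp (c j * g j).
  apply/existsP; apply: contraT; rewrite negb_exists => /forallP no.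
  have /eqP := congr1 (mcoeff m) E; rewrite mcoeffX eqxx raddf_sum big1 ?oner_eq0 //= => j _.
  by apply/eqP; rewrite mcoeff_eq0.
have [f [m' [[i iJ ->] /is_lead_F0 -> gE]]] := gF j; exists i => //.
move: mj; rewrite gE F0_lmon scale1r => /msuppM_le /allpairsP[[m1 m2] /= [_]].
by rewrite msuppX inE => /eqP -> ->; rewrite lem_addl.
Qed.

Lemma F0_groebner : groebner_basis prec F (@kerPhi0 K u d).
Proof.
have inker i : kerPhi0 u d (F i) by apply/ker_F0/ideal_gen_mem; exists i; rewrite ?inE.
split=> // x; split; apply: ideal_gen_trans => y [f [m [fP fm ->]]].
  by apply: ideal_gen_mem; exists f, m; split=> //; have [i _ ->] := fP.
have [mf lead_m] := fm.
move/kerPhi0P: fP => fib0.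
(* Cancellation inside the fibre of the leading monomial supplies a smaller monomial with the same
   image, so the test on pairs of monomials applies to every f in the kernel. *)
have [m' [m'f ne fE]] := fibre_partner fib0 mf.
have [i iq le_i] := lmon_divides_lead fE ne (lead_m _ m'f ne).
have [j jE] := pos_onto iq.
rewrite -(submK le_i) mpolyXD -mul_mpolyC mulrA; apply/ideal_genM/ideal_gen_mem.
exists (F j), (lmon (pos j)); split; [by exists j; rewrite ?inE|exact/is_lead_F0|].
by rewrite F0_lmon scale1r jE.
Qed.

Lemma F0_reduced_groebner : reduced_groebner_basis prec F (@kerPhi0 K u d).
Proof.
split; first exact: F0_groebner.
  by move=> i; exists (lmon (pos i)); [apply/is_lead_F0|rewrite F0_lmon].
move=> i m /msupp_F0 mE /monomial_ideal_lmon[j]; rewrite !inE andbT => ji.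
apply: no_division mE; try exact/pos_lt/ltn_ord.
by move=> /(pos_inj (ltn_ord i) (ltn_ord j)) /val_inj E; rewrite E eqxx in ji.
Qed.

End GroebnerBasis.

End Creation.

Theorem theorem2p2 (K : fieldType) (u d : nat)
  (u_gt0 : (0 < u)%N) (d_gt0 : (0 < d)%N) (lt_u_d2 : (2 * u < d)%N)
  (co_ud : gcdn u d = 1%N)
  (p q : nat) (a k : nat -> nat)
  (Hak : euclid_data u d p a k) (Hq : q = (\sum_(1 <= i < p) k i)%N) :
  [/\ exists (Phi1 : {linear 'rV[{mpoly K[5]}]_q.+2 -> {mpoly K[5]}^o})
             (r2 : nat) (e2 : 'I_r2 -> int * int)
             (r3 : nat) (e3 : 'I_r3 -> int * int)
             (Phi2 : {linear 'rV[{mpoly K[5]}]_r2 -> 'rV[{mpoly K[5]}]_q.+2})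
             (Phi3 : {linear 'rV[{mpoly K[5]}]_r3 -> 'rV[{mpoly K[5]}]_r2}),
        min_bigraded_resolution u d (@deg1 u d q) e2 e3 Phi1 Phi2 Phi3 /\
        forall n : 'I_q.+2, Phi1 (delta_mx 0 n) = F0 u d K n,
      minimal_generators (@F0 u d q K) (@kerPhi0 K u d)
    & reduced_groebner_basis (prec_l u d q) (@F0 u d q K) (@kerPhi0 K u d)].
Proof.
have [] := slow_euclid co_ud u_gt0 lt_u_d2 Hak; rewrite -Hq => q_gt1 bc_gt0 bc_q1.
have W_b j : (j < q)%N -> (0 < gb (slow_pair u d j).2 <= gb (slow_pair u d j).1)%N.
  by move/bc_gt0; rewrite -slow_pair_b.
have [Vq_b Wq_b] : gb (slow_pair u d q.-1).1 = 1%N /\ gb (slow_pair u d q.-1).2 = 1%N.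
  by have := bc_q1; rewrite -slow_pair_b => -[-> ->].
have le_ud : (u <= d)%N by lia.
have red := F0_reduced_groebner u_gt0 lt_u_d2 co_ud q_gt1 W_b Vq_b Wq_b K.
have kerE := ker_F0 u_gt0 lt_u_d2 co_ud q_gt1 W_b Vq_b Wq_b (K := K).
have tw := created_tower u_gt0 lt_u_d2 co_ud q_gt1 W_b Vq_b Wq_b K.
have F0_b i := F0_binom u_gt0 lt_u_d2 co_ud q_gt1 W_b Vq_b Wq_b K i.
have degE i := deg1_pos u_gt0 lt_u_d2 co_ud q_gt1 W_b Vq_b Wq_b i.
have inj (i j : 'I_q.+2) : pos u d q i = pos u d q j -> i = j.
  move=> E; apply/val_inj.
  exact: (pos_inj u_gt0 lt_u_d2 co_ud q_gt1 Vq_b Wq_b (ltn_ord i) (ltn_ord j) E).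
have ltp (i : 'I_q.+2) : (pos u d q i < q.+2)%N.
  exact: (pos_lt u_gt0 lt_u_d2 co_ud q_gt1 Vq_b Wq_b (ltn_ord i)).
(* The third free module has rank q - 1, so the resolution is stated for q = q'.+1. *)
case: q => [//|q'] in Hq q_gt1 bc_gt0 bc_q1 W_b Vq_b Wq_b red kerE tw F0_b degE inj ltp *.
split=> //; last exact: (tower_minimal tw inj ltp F0_b kerE).
have res := tower_resolution tw inj ltp F0_b degE kerE (@Phi0_onto K u d)
  (@Phi0_graded K u d le_ud).
do 7 eexists; split; first exact: res.
by move=> n; rewrite /= lincomb_delta.
Qed.
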